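(* Let $H$ be a Hilbert module over a $C^*$-algebra. For every idempotent $Q\in\mathcal{L}(H)$, with matched projection $m(Q)$, we have $$\mathcal{R}\big[m(Q)\big]\subseteq \mathcal{R}(Q+Q^* )=\mathcal{R}(|Q^*|+|Q|),$$ and $\mathcal{R}\big[m(Q)\big]=\mathcal{R}(Q+Q^* )$ if and only if $Q$ is a projection.
   Context: $\mathcal{L}(H)$ is the $C^*$-algebra of adjointable operators on the Hilbert $C^*$-module $H$, and $I$ is the identity operator on $H$. $\mathcal{R}(\cdot)$ and $\mathcal{N}(\cdot)$ denote range and null space. $|T|=(T^*T)^{1/2}$. An idempotent is $Q\in\mathcal{L}(H)$ with $Q^2=Q$; a projection is a self-adjoint idempotent. $P_{\mathcal{R}(Q)}$ is the projection of $H$ onto the (orthogonally complemented) range of $Q$. Definition of the matched projection $m(Q)$ of an idempotent $Q\in\mathcal{L}(H)$: if $Q$ is a projection, $m(Q)=Q$. Otherwise, $H=\mathcal{R}(Q)\dotplus\mathcal{N}(Q^* )$ is an orthogonal decomposition; let $U:H\to\mathcal{R}(Q)\oplus\mathcal{N}(Q^* )$ be the unitary $Uh=\binom{P_{\mathcal{R}(Q)}h}{(I-P_{\mathcal{R}(Q)})h}$, let $I_1$ be the identity on $\mathcal{R}(Q)$, let $A=(Q-P_{\mathcal{R}(Q)})|_{\mathcal{N}(Q^* )}:\mathcal{N}(Q^* )\to\mathcal{R}(Q)$ and $B=(AA^*+I_1)^{1/2}$, and set $$m(Q)=U^*\cdot\frac12\begin{pmatrix}(B+I_1)B^{-1} &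 B^{-1}A\\ A^*B^{-1} & A^*[B(B+I_1)]^{-1}A\end{pmatrix}\cdot U .$$ *)

(* Defs.v *)
From HB Require Import structures.
From mathcomp Require Import all_boot all_order all_algebra.
From mathcomp Require Import complex.
From mathcomp Require Import all_classical all_reals all_analysis.

Set Implicit Arguments.
Unset Strict Implicit.
Unset Printing Implicit Defensive.

Import Order.TTheory GRing.Theory Num.Theory.
Import numFieldNormedType.Exports.

Local Open Scope classical_set_scope.
Local Open Scope ring_scope.

(* C*-algebras need not have a unit, so they cannot be built on the (unital)
   MathComp ring structures. *)
HB.mixin Record CompleteNormedModule_isCStarAlgebra (R : realType) A
    of CompleteNormedModule R[i] A := {
  amul : A -> A -> A;
  astar : A -> A;
  amulA : associative amul;
  amulDl : left_distributive amul +%R;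
  amulDr : right_distributive amul +%R;
  amulZl : forall (c : R[i]) a b, amul (c *: a) b = c *: amul a b;
  amulZr : forall (c : R[i]) a b, amul a (c *: b) = c *: amul a b;
  ler_norm_amul : forall a b, `|amul a b| <= `|a| * `|b|;
  astarK : involutive astar;
  astarD : {morph astar : a b / a + b};
  astarZ : forall (c : R[i]) a, astar (c *: a) = c^* *: astar a;
  astarM : forall a b, astar (amul a b) = amul (astar b) (astar a);
  norm_cstar : forall a, `|amul (astar a) a| = `|a| ^+ 2
}.

#[short(type="cstarAlgType")]
HB.structure Definition CStarAlgebra (R : realType) :=
  {A of CompleteNormedModule_isCStarAlgebra R A & CompleteNormedModule R[i] A}.

Definition apos (R : realType) (A : cstarAlgType R) (a : A) :=
  exists b : A, a = amul (astar b) b.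

(* A complex vector space that is a right A-module with a Hermitian A-valued
   form, conjugate-linear on the left and A-linear on the right.  Positivity,
   definiteness and completeness are only required in [hilbertModType];
   submodules and direct sums of Hilbert modules are used through this weaker
   structure, which is all that adjoints depend on. *)
HB.mixin Record Lmodule_isInnerModule (R : realType) (A : cstarAlgType R) E
    of GRing.Lmodule R[i] E := {
  hact : E -> A -> E;
  inner : E -> E -> A;
  hactDl : forall x y a, hact (x + y) a = hact x a + hact y a;
  hactDr : forall x a b, hact x (a + b) = hact x a + hact x b;
  hactA : forall x a b, hact (hact x a) b = hact x (amul a b);
  hactZl : forall (c : R[i]) x a, hact (c *: x) a = c *: hact x a;
  hactZr : forall (c : R[i]) x a, hact x (c *: a) = c *: hact x a;
  innerDr : forall x y z, inner x (y + z) = inner x y + inner x z;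
  innerZr : forall (c : R[i]) x y, inner x (c *: y) = c *: inner x y;
  inner_act : forall x y a, inner x (hact y a) = amul (inner x y) a;
  innerC : forall x y, inner y x = astar (inner x y)
}.

#[short(type="innerModType")]
HB.structure Definition InnerModule (R : realType) (A : cstarAlgType R) :=
  {E of GRing.Lmodule R[i] E & Lmodule_isInnerModule R A E}.

HB.mixin Record InnerModule_isHilbert (R : realType) (A : cstarAlgType R) H
    of CompleteNormedModule R[i] H & InnerModule R A H := {
  inner_pos : forall x : H, apos (inner x x : A);
  inner_eq0 : forall x : H, inner x x = 0 :> A -> x = 0;
  norm_inner : forall x : H, `|x| ^+ 2 = `|inner x x : A|
}.

#[short(type="hilbertModType")]
HB.structure Definition HilbertModule (R : realType) (A : cstarAlgType R) :=
  {H of CompleteNormedModule R[i] H & InnerModule R A H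
      & InnerModule_isHilbert R A H}.

Section DirectSum.
Context (R : realType) (A : cstarAlgType R) (E F : innerModType A).
Implicit Types u v w : (E * F)%type.

Definition pair_act u (a : A) : (E * F)%type := (hact u.1 a, hact u.2 a).
Definition pair_inner u v : A := inner u.1 v.1 + inner u.2 v.2.

Let pair_actDl u v a : pair_act (u + v) a = pair_act u a + pair_act v a.
Proof. by congr pair; exact: hactDl. Qed.

Let pair_actDr u a b : pair_act u (a + b) = pair_act u a + pair_act u b.
Proof. by congr pair; exact: hactDr. Qed.

Let pair_actA u a b : pair_act (pair_act u a) b = pair_act u (amul a b).
Proof. by congr pair; exact: hactA. Qed.

Let pair_actZl (c : R[i]) u a : pair_act (c *: u) a = c *: pair_act u a.
Proof. by congr pair; exact: hactZl. Qed.

Let pair_actZr (c : R[i]) u a : pair_act u (c *: a) = c *: pair_act u a.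
Proof. by congr pair; exact: hactZr. Qed.

Let pair_innerDr u v w : pair_inner u (v + w) = pair_inner u v + pair_inner u w.
Proof. by rewrite /pair_inner !innerDr addrACA. Qed.

Let pair_innerZr (c : R[i]) u v : pair_inner u (c *: v) = c *: pair_inner u v.
Proof. by rewrite /pair_inner !innerZr scalerDr. Qed.

Let pair_inner_act u v a : pair_inner u (pair_act v a) = amul (pair_inner u v) a.
Proof. by rewrite /pair_inner !inner_act amulDl. Qed.

Let pair_innerC u v : pair_inner v u = astar (pair_inner u v).
Proof. by rewrite /pair_inner astarD -!innerC. Qed.

HB.instance Definition _ := Lmodule_isInnerModule.Build R A (E * F)%type
  pair_actDl pair_actDr pair_actA pair_actZl pair_actZr pair_innerDr pair_innerZr pair_inner_act pair_innerC.

End DirectSum.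

Section Submodule.
Context (R : realType) (A : cstarAlgType R) (H : innerModType A).

Record submodule := Submodule {
  submodule_pred :> {pred H};
  submodule_closed : submod_closed submodule_pred;
  submodule_act : forall x a,
    x \in submodule_pred -> hact x a \in submodule_pred
}.

HB.instance Definition _ (S : submodule) := GRing.isSubmodClosed.Build
  R[i] H (submodule_pred S) (submodule_closed S).

Record submodule_of (S : submodule) := SubmoduleOf {
  submodule_val :> H;
  _ : submodule_val \in submodule_pred S
}.

Variable S : submodule.

HB.instance Definition _ := [isSub for @submodule_val S].
HB.instance Definition _ := [Choice of submodule_of S by <:].
HB.instance Definition _ :=
  [SubChoice_isSubLmodule of submodule_of S by <:].

Implicit Types x y z : submodule_of S.

Definition sub_act x (a : A) : submodule_of S := SubmoduleOf (submodule_act a (valP x)).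
Definition sub_inner x y : A := inner (val x) (val y).

Let sub_actDl x y a : sub_act (x + y) a = sub_act x a + sub_act y a.
Proof. by apply: val_inj; rewrite raddfD /= -hactDl. Qed.

Let sub_actDr x a b : sub_act x (a + b) = sub_act x a + sub_act x b.
Proof. by apply: val_inj; rewrite raddfD /= -hactDr. Qed.

Let sub_actA x a b : sub_act (sub_act x a) b = sub_act x (amul a b).
Proof. by apply: val_inj; rewrite /= -hactA. Qed.

Let sub_actZl (c : R[i]) x a : sub_act (c *: x) a = c *: sub_act x a.
Proof. by apply: val_inj; rewrite linearZ /= -hactZl. Qed.

Let sub_actZr (c : R[i]) x a : sub_act x (c *: a) = c *: sub_act x a.
Proof. by apply: val_inj; rewrite linearZ /= -hactZr. Qed.

Let sub_innerDr x y z : sub_inner x (y + z) = sub_inner x y + sub_inner x z.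
Proof. by rewrite /sub_inner raddfD innerDr. Qed.

Let sub_innerZr (c : R[i]) x y : sub_inner x (c *: y) = c *: sub_inner x y.
Proof. by rewrite /sub_inner linearZ innerZr. Qed.

Let sub_inner_act x y a : sub_inner x (sub_act y a) = amul (sub_inner x y) a.
Proof. by rewrite /sub_inner -inner_act. Qed.

Let sub_innerC x y : sub_inner y x = astar (sub_inner x y).
Proof. by rewrite /sub_inner innerC. Qed.

HB.instance Definition _ := Lmodule_isInnerModule.Build R A (submodule_of S)
  sub_actDl sub_actDr sub_actA sub_actZl sub_actZr sub_innerDr sub_innerZr sub_inner_act sub_innerC.

End Submodule.

Section Adjoint.
Context (R : realType) (A : cstarAlgType R).
Implicit Types E F : innerModType A.

Definition is_adjoint E F (T : E -> F) (T' : F -> E) :=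
  forall x y, inner (T x) y = inner x (T' y) :> A.

Definition adjointable E F (T : E -> F) := exists T', is_adjoint T T'.

(* The adjoint of T when T is adjointable, and 0 otherwise. *)
Definition adj E F (T : E -> F) : F -> E :=
  xget (fun=> 0) [set T' : F -> E | is_adjoint T T'].

Definition projection E (T : E -> E) := is_adjoint T T /\ T \o T = T.

(* Positivity in the C*-algebra of adjointable operators on E. *)
Definition oppos E (T : E -> E) :=
  exists S : E -> E, adjointable S /\ T = adj S \o S.

(* The positive square root of a positive adjointable operator. *)
Definition opsqrt E (T : E -> E) : E -> E :=
  xget (fun=> 0) [set S : E -> E | oppos S /\ S \o S = T].

Definition opabs E F (T : E -> F) : E -> E := opsqrt (adj T \o T).

(* The two-sided inverse of an invertible operator. *)
Definition opinv E F (T : E -> F) : F -> E :=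
  xget (fun=> 0) [set S : F -> E | S \o T = id /\ T \o S = id].

Definition range_proj E (T : E -> E) : E -> E :=
  xget (fun=> 0) [set P : E -> E | projection P /\ range P = range T].

End Adjoint.

Section AdjointableOperators.
Context (R : realType) (A : cstarAlgType R) (H : hilbertModType A).

Record adjOp := AdjOp {
  adjOp_fun :> H -> H;
  adjOpP : adjointable adjOp_fun
}.

Lemma inner_inj (x y : H) :
  (forall z : H, inner z x = inner z y :> A) -> x = y.
Proof.
move=> xy; apply/subr0_eq/inner_eq0.
set z := x - y; rewrite {2}/z -scaleN1r innerDr innerZr xy.
by rewrite scaleN1r subrr.
Qed.

Lemma is_adjoint_sym (T T' : H -> H) : is_adjoint T T' -> is_adjoint T' T.
Proof. by move=> TT' x y; rewrite innerC -TT' -innerC. Qed.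

Lemma is_adjointP (T T' : H -> H) : is_adjoint T T' -> adj T = T'.
Proof.
move=> TT'; rewrite /adj; case: xgetP => [S -> /= TS|/(_ T')//].
by apply/funext => y; apply: inner_inj => z; rewrite -TS TT'.
Qed.

Lemma adjP (T : adjOp) : is_adjoint T (adj T).
Proof. by have [T' TT'] := adjOpP T; rewrite (is_adjointP TT'). Qed.

Lemma adjOp_linear (T : adjOp) (c : R[i]) (x y : H) :
  T (c *: x + y) = c *: T x + T y.
Proof.
apply: inner_inj => z; have sT := is_adjoint_sym (adjP T).
by rewrite innerDr innerZr -!sT innerDr innerZr.
Qed.

Lemma adjOp_act (T : adjOp) (x : H) (a : A) : T (hact x a) = hact (T x) a.
Proof.
apply: inner_inj => z; have sT := is_adjoint_sym (adjP T).
by rewrite inner_act -!sT inner_act.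
Qed.

Lemma adjOp0 (T : adjOp) : T 0 = 0.
Proof.
by have := adjOp_linear T (-1) 0 0; rewrite scaler0 addr0 scaleN1r addNr.
Qed.

Definition adjOp_adj (T : adjOp) : adjOp :=
  AdjOp (ex_intro _ (T : H -> H) (is_adjoint_sym (adjP T))).

Lemma range_submod_closed (T : adjOp) : submod_closed (mem (range T)).
Proof.
split=> [|c x y]; first by apply/mem_set; exists 0 => //; exact: adjOp0.
move=> /set_mem[u _ <-] /set_mem[v _ <-]; apply/mem_set.
by exists (c *: u + v) => //; exact: adjOp_linear.
Qed.

Lemma range_act (T : adjOp) x a :
  x \in mem (range T) -> hact x a \in mem (range T).
Proof.
move=> /set_mem[u _ <-]; apply/mem_set.
by exists (hact u a) => //; exact: adjOp_act.
Qed.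

Definition range_sub (T : adjOp) : submodule H :=
  Submodule (@range_submod_closed T) (@range_act T).

Lemma null_submod_closed (T : adjOp) : submod_closed [pred x | T x == 0].
Proof.
split=> [|c x y]; rewrite !inE; first by rewrite adjOp0.
by move=> /eqP Tx /eqP Ty; rewrite adjOp_linear Tx Ty scaler0 addr0.
Qed.

Lemma null_act (T : adjOp) x a :
  x \in [pred x | T x == 0] -> hact x a \in [pred x | T x == 0].
Proof.
rewrite !inE => /eqP Tx; apply/eqP.
by rewrite adjOp_act Tx -(scale0r 0) hactZl !scale0r.
Qed.

Definition null_sub (T : adjOp) : submodule H :=
  Submodule (@null_submod_closed T) (@null_act T).

End AdjointableOperators.

Notation "''L' ( H )" := (adjOp H) (at level 8, format "''L' ( H )").

Section MatchedProjection.
Context (R : realType) (A : cstarAlgType R) (H : hilbertModType A).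
Variable Q : 'L(H).

Local Notation rQ := (submodule_of (range_sub Q)).
Local Notation nQ := (submodule_of (null_sub (adjOp_adj Q))).
Local Notation P := (range_proj Q).

(* [insubd 0 x] is x seen as an element of the submodule; for Q idempotent it
   is only applied to vectors of that submodule. *)
Definition mp_U (h : H) : rQ * nQ := (insubd 0 (P h), insubd 0 (h - P h)).

Definition mp_A (y : nQ) : rQ := insubd 0 (Q (val y) - P (val y)).

Definition mp_B : rQ -> rQ := opsqrt (mp_A \o adj mp_A \+ id).

(* The action on the direct sum of the 2 x 2 operator matrix, without the
   factor 1/2. *)
Definition mp_mx (u : rQ * nQ) : rQ * nQ :=
  let B := mp_B in let A := mp_A in
  ( ((B \+ id) \o opinv B) u.1 + (opinv B \o A) u.2,
    (adj A \o opinv B) u.1 + (adj A \o opinv (B \o (B \+ id)) \o A) u.2 ).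

Definition matched_proj : H -> H :=
  if `[< projection Q >] then Q : H -> H
  else adj mp_U \o (fun u => 2^-1 *: mp_mx u) \o mp_U.

End MatchedProjection.

(* Main.v *)
(* Write Q' for the adjoint of Q, and put J = Q + Q' - 1. Then
   J^2 = 1 + (Q - Q')' (Q - Q') is invertible and commutes with Q and Q'. Let N
   be its positive square root and P the projection onto the range of Q. From
   P J^2 = Q Q' one gets |Q'| = N P = Q Q' N^-1 and |Q| = Q' N^-1 Q = Q' Q N^-1,
   hence |Q'| + |Q| = (Q + Q') J N^-1, which has the range of Q + Q'. The
   operator B in the definition of m(Q) is the restriction of N to the range of
   Q, and m(Q) = W (2 N (N + 1))^-1 W' with W = (N + Q') P. So m(Q) has the
   range of W = (Q + Q') (P N + Q' P) (N + 1)^-1. If this range contains Q y for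
   every y in the null space of Q', then Q y = W x forces Q' P x = P x, then
   N P x = P x, so that Q' Q y = Q y and <Q y, Q y> = <y, Q y> = 0: thus Q = P.

   All this rests on unique positive square roots of adjointable operators, that
   is, on Fukamiya's theorem that T' T is positive. Positivity of a selfadjoint a
   is expressed as ||t - a|| <= t for some t >= 0. The norm estimates need the
   Cauchy-Schwarz inequality; it is trivial for the algebra A as a module over
   itself, and positivity of operators on A then gives it for every module. *)
Require Import Defs.
From HB Require Import structures.
From mathcomp Require Import all_boot all_order all_algebra.
From mathcomp Require Import complex.
From mathcomp Require Import all_classical all_reals all_analysis.
From mathcomp Require Import ring lra.
From Stdlib Require Ncring Ncring_tac.

Set Implicit Arguments.
Unset Strict Implicit.
Unset Printing Implicit Defensive.

Import Order.TTheory GRing.Theory Num.Theory.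
Import numFieldNormedType.Exports.
Local Open Scope classical_set_scope.
Local Open Scope ring_scope.
Local Open Scope complex_scope.

(** * Real-valued norms and completeness *)

Lemma complex_mulii (R : rcfType) : 'i * 'i = -1 :> R[i].
Proof. by rewrite -expr2 sqr_i. Qed.

Lemma complex_conji (R : rcfType) : Num.conj ('i : R[i]) = - 'i.
Proof. by apply/eqP; rewrite eq_complex /= oppr0 !eqxx. Qed.

Section RealNorm.
Context (R : realType) (V : normedModType R[i]).
Implicit Types x y z : V.

(** The norm takes values in [R[i]]; its real part gives access to real order arithmetic. *)
Definition rnorm x : R := complex.Re `|x|.

Lemma rnormE x : `|x| = (rnorm x)%:C.
Proof. by rewrite /rnorm RRe_real // ger0_real. Qed.

Lemma rnorm_ge0 x : 0 <= rnorm x.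
Proof. by rewrite -lecR -rnormE; exact: normr_ge0. Qed.

Lemma ler_rnormD x y : rnorm (x + y) <= rnorm x + rnorm y.
Proof. by rewrite -lecR rmorphD /= -!rnormE ler_normD. Qed.

Lemma rnormN x : rnorm (- x) = rnorm x.
Proof. by rewrite /rnorm normrN. Qed.

Lemma ler_rnormB x y : rnorm (x - y) <= rnorm x + rnorm y.
Proof. by rewrite -(rnormN y) ler_rnormD. Qed.

Lemma rnorm0 : rnorm 0 = 0.
Proof. by rewrite /rnorm normr0. Qed.

Lemma rnorm_eq0 x : rnorm x = 0 -> x = 0.
Proof. by move=> x0; apply/eqP; rewrite -normr_eq0 rnormE x0. Qed.

Lemma rnorm_gt0 x : x != 0 -> 0 < rnorm x.
Proof.
move=> x0; rewrite lt_neqAle rnorm_ge0 andbT eq_sym.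
by apply: contra_neq x0; exact: rnorm_eq0.
Qed.

Lemma rnormZ (c : R) x : rnorm (c%:C *: x) = `|c| * rnorm x.
Proof.
apply: complexI; rewrite -rnormE normrZ rnormE rmorphM /=; congr (_ * _).
by rewrite normc_def /= expr0n addr0 sqrtr_sqr.
Qed.

Lemma rnorm_double x : rnorm (x + x) = 2 * rnorm x.
Proof.
have -> : x + x = (2%:R : R)%:C *: x by rewrite rmorph_nat scaler_nat mulr2n.
by rewrite rnormZ ger0_norm.
Qed.

Lemma rnormZi x : rnorm ('i *: x) = rnorm x.
Proof.
by rewrite /rnorm normrZ normc_def /= expr0n expr1n add0r sqrtr1 mul1r.
Qed.

Lemma rnorm_limit_eq0 x : (forall e : R, 0 < e -> rnorm x <= e) -> x = 0.
Proof.
move=> small; apply: rnorm_eq0; apply/eqP; rewrite eq_le rnorm_ge0 andbT.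
by apply/ler_addgt0Pr => e /small; rewrite add0r.
Qed.

End RealNorm.

Section Completeness.
Context (R : realType) (V : completeNormedModType R[i]).

(** The increments are dominated by those of a convergent real sequence, so [x] is Cauchy. The
    explicit error [l - e n] is what later lets identities pass to the limit. *)
Lemma complete_majorized (x : nat -> V) (e : nat -> R) (l : R) :
  e @ \oo --> l ->
  (forall n, rnorm (x n.+1 - x n) <= e n.+1 - e n) ->
  exists y, forall n, rnorm (y - x n) <= l - e n.
Proof.
move=> e_l xe.
have x_le m n : (m <= n)%N -> rnorm (x n - x m) <= e n - e m.
  elim: n => [|n IHn]; first by rewrite leqn0 => /eqP ->; rewrite !subrr rnorm0.
  rewrite leq_eqVlt => /predU1P[->|/IHn le_mn]; first by rewrite !subrr rnorm0.
  have -> : x n.+1 - x m = (x n.+1 - x n) + (x n - x m) by rewrite addrA subrK.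
  apply: le_trans (ler_rnormD _ _) _; have := xe n; lra.
have e_nd : nondecreasing_seq e.
  apply/nondecreasing_seqP => n; rewrite -subr_ge0.
  exact: le_trans (rnorm_ge0 _) (xe n).
have e_le n : e n <= l.
  have -> : l = limn e by apply/esym/cvg_lim.
  by apply: nondecreasing_cvgn_le => //; apply/cvg_ex; exists l.
have x_cvg : cvgn x.
  apply: cauchy_cvg; apply: cauchy_exP => eps.
  rewrite ltcE => /andP[/eqP Im_eps /= eps0].
  have [N _ eN] : \forall n \near \oo, l - complex.Re eps < e n.
    by apply: (cvgr_gt l) => //; rewrite ltrBlDr ltrDl.
  exists (x N); exists N => // n /= Nn.
  rewrite -ball_normE /= -opprB normrN rnormE ltcE /= Im_eps eqxx /=.
  apply: le_lt_trans (x_le _ _ Nn) _.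
  by have := eN N (leqnn N); have := e_le n => /=; lra.
exists (limn x) => n; apply/ler_addgt0Pr => eps eps0.
have [N _ xN] : \forall m \near \oo, ball (limn x) eps%:C (x m).
  by move/cvg_ballP: x_cvg; apply; rewrite ltcR.
have := xN (maxn N n) (leq_maxl _ _).
rewrite -ball_normE /= rnormE ltcR => lim_x.
have -> : limn x - x n = (limn x - x (maxn N n)) + (x (maxn N n) - x n).
  by rewrite addrA subrK.
apply: le_trans (ler_rnormD _ _) _; have := x_le _ _ (leq_maxr N n).
by have := e_le (maxn N n); lra.
Qed.

End Completeness.

(** * The ring of adjointable operators *)

Section InnerModules.
Context (R : realType) (A : cstarAlgType R) (E : innerModType A).
Implicit Types x y z : E.

Lemma innerDl x y z : inner (x + y) z = inner x z + inner y z :> A.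
Proof. by rewrite innerC innerDr astarD -!innerC. Qed.

Lemma innerZl (c : R[i]) x y : inner (c *: x) y = c^* *: inner x y :> A.
Proof. by rewrite innerC innerZr astarZ -innerC. Qed.

Lemma inner0r x : inner x 0 = 0 :> A.
Proof. by have := innerZr 0 x 0; rewrite !scale0r. Qed.

Lemma inner0l x : inner 0 x = 0 :> A.
Proof. by have := innerZl 0 0 x; rewrite conjC0 !scale0r. Qed.

Lemma innerNr x y : inner x (- y) = - inner x y :> A.
Proof. by rewrite -scaleN1r innerZr scaleN1r. Qed.

Lemma innerNl x y : inner (- x) y = - inner x y :> A.
Proof. by rewrite -scaleN1r innerZl conjCN1 scaleN1r. Qed.

Lemma innerBr x y z : inner x (y - z) = inner x y - inner x z :> A.
Proof. by rewrite innerDr innerNr. Qed.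

Lemma innerBl x y z : inner (x - y) z = inner x z - inner y z :> A.
Proof. by rewrite innerDl innerNl. Qed.

Lemma inner_actl x y a : inner (hact x a) y = amul (astar a) (inner x y) :> A.
Proof. by rewrite innerC inner_act astarM -innerC. Qed.

End InnerModules.

Section OperatorRing.
Context (R : realType) (A : cstarAlgType R) (H : hilbertModType A).
Implicit Types S T : 'L(H).

Lemma adjOp_eqP S T : S =1 T -> S = T.
Proof.
case: S T => [S aS] [T aT] /= /funext ST; case: T / ST aT => aT.
by congr AdjOp; exact: Prop_irrelevance.
Qed.

HB.instance Definition _ := gen_eqMixin 'L(H).
HB.instance Definition _ := gen_choiceMixin 'L(H).

Lemma adjOpD T x y : T (x + y) = T x + T y.
Proof. by have := adjOp_linear T 1 x y; rewrite !scale1r. Qed.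

Lemma adjOpZ T (c : R[i]) x : T (c *: x) = c *: T x.
Proof. by have := adjOp_linear T c x 0; rewrite !addr0 adjOp0 addr0. Qed.

Lemma adjOpN T x : T (- x) = - T x.
Proof. by rewrite -scaleN1r adjOpZ scaleN1r. Qed.

Lemma adjOpB T x y : T (x - y) = T x - T y.
Proof. by rewrite adjOpD adjOpN. Qed.

Fact op_zero_adjointable : adjointable (fun _ : H => 0 : H).
Proof. by exists (fun=> 0) => x y; rewrite inner0l inner0r. Qed.

Fact op_one_adjointable : adjointable (fun x : H => x).
Proof. by exists id. Qed.

Fact op_add_adjointable S T : adjointable (fun x => S x + T x).
Proof.
by exists (adj S \+ adj T) => x y; rewrite innerDl innerDr !adjP.
Qed.

Fact op_opp_adjointable T : adjointable (fun x => - T x).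
Proof. by exists (\- adj T) => x y; rewrite innerNl innerNr adjP. Qed.

Fact op_mul_adjointable S T : adjointable (fun x => S (T x)).
Proof. by exists (adj T \o adj S) => x y /=; rewrite !adjP. Qed.

Fact op_scale_adjointable (c : R[i]) T : adjointable (fun x => c *: T x).
Proof.
exists (fun y => c^* *: adj T y) => x y.
by rewrite innerZl innerZr adjP.
Qed.

Definition op_zero : 'L(H) := AdjOp op_zero_adjointable.
Definition op_one : 'L(H) := AdjOp op_one_adjointable.
Definition op_add S T : 'L(H) := AdjOp (op_add_adjointable S T).
Definition op_opp T : 'L(H) := AdjOp (op_opp_adjointable T).
Definition op_mul S T : 'L(H) := AdjOp (op_mul_adjointable S T).
Definition op_scale (c : R[i]) T : 'L(H) := AdjOp (op_scale_adjointable c T).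

Fact op_addA : associative op_add.
Proof. by move=> S T U; apply: adjOp_eqP => x /=; rewrite addrA. Qed.

Fact op_addC : commutative op_add.
Proof. by move=> S T; apply: adjOp_eqP => x /=; rewrite addrC. Qed.

Fact op_add0 : left_id op_zero op_add.
Proof. by move=> T; apply: adjOp_eqP => x /=; rewrite add0r. Qed.

Fact op_addN : left_inverse op_zero op_opp op_add.
Proof. by move=> T; apply: adjOp_eqP => x /=; rewrite addNr. Qed.

HB.instance Definition _ :=
  GRing.isZmodule.Build 'L(H) op_addA op_addC op_add0 op_addN.

Fact op_mulA : associative op_mul.
Proof. by move=> S T U; apply: adjOp_eqP. Qed.

Fact op_mul1l : left_id op_one op_mul.
Proof. by move=> T; apply: adjOp_eqP. Qed.

Fact op_mul1r : right_id op_one op_mul.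
Proof. by move=> T; apply: adjOp_eqP. Qed.

Fact op_mulDl : left_distributive op_mul +%R.
Proof. by move=> S T U; apply: adjOp_eqP. Qed.

Fact op_mulDr : right_distributive op_mul +%R.
Proof. by move=> S T U; apply: adjOp_eqP => x /=; rewrite adjOpD. Qed.

HB.instance Definition _ := GRing.Zmodule_isPzRing.Build 'L(H)
  op_mulA op_mul1l op_mul1r op_mulDl op_mulDr.

Fact op_scaleA (a b : R[i]) T : op_scale a (op_scale b T) = op_scale (a * b) T.
Proof. by apply: adjOp_eqP => x /=; rewrite scalerA. Qed.

Fact op_scale1 : left_id 1 op_scale.
Proof. by move=> T; apply: adjOp_eqP => x /=; rewrite scale1r. Qed.

Fact op_scaleDr : right_distributive op_scale +%R.
Proof. by move=> c S T; apply: adjOp_eqP => x /=; rewrite scalerDr. Qed.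

Fact op_scaleDl T : {morph op_scale^~ T : a b / a + b}.
Proof. by move=> a b; apply: adjOp_eqP => x /=; rewrite scalerDl. Qed.

HB.instance Definition _ := GRing.Zmodule_isLmodule.Build R[i] 'L(H)
  op_scaleA op_scale1 op_scaleDr op_scaleDl.

Lemma opE : ((forall x, (0 : 'L(H))%R x = 0%R :> H)
  * (forall x, (1 : 'L(H))%R x = x :> H)
  * (forall S T x, (S + T)%R x = (S x + T x)%R :> H)
  * (forall T x, (- T)%R x = (- T x)%R :> H)
  * (forall S T x, (S * T)%R x = S (T x) :> H)
  * (forall (c : R[i]) T x, (c *: T)%R x = (c *: T x)%R :> H))%type.
Proof. by []. Qed.

Lemma op_scaleAl (c : R[i]) S T : (c *: S) * T = c *: (S * T).
Proof. exact: adjOp_eqP. Qed.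

Lemma op_scaleAr (c : R[i]) S T : S * (c *: T) = c *: (S * T).
Proof. by apply: adjOp_eqP => x; rewrite !opE adjOpZ. Qed.

Definition star T : 'L(H) := adjOp_adj T.

Lemma inner_star T x y : inner (T x) y = inner x (star T y) :> A.
Proof. exact: adjP. Qed.

Lemma inner_starl T x y : inner (star T x) y = inner x (T y) :> A.
Proof. by rewrite innerC -inner_star -innerC. Qed.

Lemma star_unique T T' : is_adjoint T T' -> star T = T'.
Proof. by move=> TT'; apply: adjOp_eqP => x /=; rewrite (is_adjointP TT'). Qed.

Lemma starK : involutive star.
Proof. by move=> T; apply: star_unique => x y; rewrite inner_starl. Qed.

Lemma star0 : star 0 = 0.
Proof. by apply: star_unique => x y; rewrite !opE inner0l inner0r. Qed.

Lemma star1 : star 1 = 1.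
Proof. exact: star_unique. Qed.

Lemma starD S T : star (S + T) = star S + star T.
Proof.
by apply: star_unique => x y; rewrite !opE innerDl innerDr !inner_star.
Qed.

Lemma starN T : star (- T) = - star T.
Proof.
by apply: star_unique => x y; rewrite !opE innerNl innerNr !inner_star.
Qed.

Lemma starB S T : star (S - T) = star S - star T.
Proof. by rewrite starD starN. Qed.

Lemma starM S T : star (S * T) = star T * star S.
Proof. by apply: star_unique => x y; rewrite !opE !inner_star. Qed.

Lemma starZ (c : R[i]) T : star (c *: T) = c^* *: star T.
Proof.
by apply: star_unique => x y; rewrite !opE innerZl innerZr !inner_star.
Qed.

Lemma starZ_real (c : R) T : star (c%:C *: T) = c%:C *: star T.
Proof.
rewrite starZ; congr (_ *: _); apply: conj_Creal.
by rewrite realE !lecR le_total.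
Qed.

Lemma star_mulr_eq0 T : star T * T = 0 -> T = 0.
Proof.
move=> T0; apply: adjOp_eqP => x; apply: (@inner_eq0 _ _ H).
by rewrite inner_star -[star T _]/((star T * T) x) T0 inner0r.
Qed.

End OperatorRing.

(** Lets the noncommutative ring tactic expand products in MathComp rings, in particular in the ring
    of operators. *)
#[local] Instance ncring_ops (R : pzRingType) : @Ncring.Ring_ops R 0 1 +%R *%R
  (fun x y => x - y) -%R (@eq R) := {}.

#[local] Instance ncring_ring (R : pzRingType) :
  @Ncring.Ring R _ _ _ _ _ _ _ (ncring_ops R).
Proof.
constructor; try exact _; first
  [ by move=> x _ <- y _ <- | by move=> x _ <- | exact: add0r | exact: addrC
  | exact: addrA | exact: mul1r | exact: mulr1 | exact: mulrA | exact: mulrDl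
  | by move=> x y z; exact: mulrDr | exact: subrr | by [] ].
Qed.

Ltac ncring := Ncring_tac.non_commutative_ring.

(** * Operator bounds *)

Section OperatorBounds.
Context (R : realType) (A : cstarAlgType R) (H : hilbertModType A).
Implicit Types (S T : 'L(H)) (j k : R).

(** Explicit bounds stand in for the operator norm, so that no supremum has to be formed. *)
Definition bounded_by T k := forall x : H, rnorm (T x) <= k * rnorm x.

Lemma rnorm_inner (x : H) : rnorm (inner x x : A) = rnorm x ^+ 2.
Proof. by apply: complexI; rewrite -rnormE -norm_inner rnormE rmorphXn. Qed.

Lemma bounded_by_ge T j k : bounded_by T j -> j <= k -> bounded_by T k.
Proof.
by move=> Tj jk x; apply: le_trans (Tj x) _; rewrite ler_wpM2r ?rnorm_ge0.
Qed.

Lemma bounded_byD S T j k :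
  bounded_by S j -> bounded_by T k -> bounded_by (S + T) (j + k).
Proof.
move=> Sj Tk x; rewrite opE; apply: le_trans (ler_rnormD _ _) _.
by rewrite mulrDl lerD.
Qed.

Lemma bounded_byN T k : bounded_by T k -> bounded_by (- T) k.
Proof. by move=> Tk x; rewrite opE rnormN. Qed.

Lemma bounded_byM S T j k : 0 <= j ->
  bounded_by S j -> bounded_by T k -> bounded_by (S * T) (j * k).
Proof.
move=> j0 Sj Tk x; rewrite opE; apply: le_trans (Sj _) _.
by rewrite -mulrA ler_wpM2l.
Qed.

Lemma bounded_byZ (c : R) T k :
  0 <= c -> bounded_by T k -> bounded_by (c%:C *: T) (c * k).
Proof.
move=> c0 Tk x; rewrite opE rnormZ ger0_norm// -mulrA.
by rewrite ler_wpM2l.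
Qed.

Lemma bounded_by0 k : 0 <= k -> bounded_by (0 : 'L(H)) k.
Proof. by move=> k0 x; rewrite opE rnorm0 mulr_ge0 ?rnorm_ge0. Qed.

Lemma bounded_by1 : bounded_by (1 : 'L(H)) 1.
Proof. by move=> x; rewrite opE mul1r. Qed.

Lemma bounded_by_limit T k :
  (forall e, 0 < e -> bounded_by T (k + e)) -> bounded_by T k.
Proof.
move=> Tk x; apply/ler_addgt0Pr => e e0.
have x1 : 0 < rnorm x + 1 by have := rnorm_ge0 x; lra.
have := Tk (e / (rnorm x + 1)) (divr_gt0 e0 x1) x.
rewrite mulrDl => /le_trans; apply.
rewrite lerD2l -mulrA ler_piMr//; first exact: ltW.
by rewrite mulrC ler_pdivrMr// mul1r; lra.
Qed.

Lemma bounded_by_eq0 T : (forall e, 0 < e -> bounded_by T e) -> T = 0.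
Proof.
move=> T0; apply: adjOp_eqP => x; apply: rnorm_eq0; apply/eqP.
rewrite eq_le rnorm_ge0 andbT -(mul0r (rnorm x)).
by apply: (@bounded_by_limit T 0) => e e0; rewrite add0r; exact: T0.
Qed.

Lemma bounded_isometry (c : R) T :
  0 <= c -> star T * T = c%:C *: (1 : 'L(H)) -> bounded_by T (Num.sqrt c).
Proof.
move=> c0 TT x.
rewrite -(@ler_pXn2r _ 2) ?nnegrE ?rnorm_ge0 ?mulr_ge0 ?sqrtr_ge0 ?rnorm_ge0//.
rewrite exprMn sqr_sqrtr// -!rnorm_inner inner_star.
by rewrite -[star T _]/((star T * T) x) TT !opE innerZr rnormZ ger0_norm.
Qed.

(* A hypothesis until [hilbert_cauchy_schwarz]: its proof uses the results below
   for the module [A] itself. *)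
Definition cauchy_schwarz :=
  forall x y : H, rnorm (inner x y : A) <= rnorm x * rnorm y.

Hypothesis cs : cauchy_schwarz.

Lemma bounded_cstar T k :
  0 <= k -> bounded_by (star T * T) (k ^+ 2) -> bounded_by T k.
Proof.
move=> k0 Tk x.
rewrite -(@ler_pXn2r _ 2) ?nnegrE ?rnorm_ge0 ?mulr_ge0 ?rnorm_ge0//.
rewrite -rnorm_inner inner_star; apply: le_trans (cs _ _) _.
apply: le_trans (ler_wpM2l (rnorm_ge0 x) (Tk x)) _.
by rewrite mulrCA exprMn expr2 (expr2 (rnorm x)) -expr2.
Qed.

(** [<T^* x, T^* x> = <x, T (T^* x)>] has norm at most [k * rnorm x * rnorm (T^* x)]; one factor
    [rnorm (T^* x)] cancels. *)
Lemma bounded_star T k : 0 <= k -> bounded_by T k -> bounded_by (star T) k.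
Proof.
move=> k0 Tk x; have [->|Tx0] := eqVneq (star T x) 0.
  by rewrite rnorm0 mulr_ge0 ?rnorm_ge0.
rewrite -(ler_pM2l (rnorm_gt0 Tx0)) -expr2 -rnorm_inner inner_starl.
apply: le_trans (cs _ _) _; rewrite mulrC mulrA ler_wpM2r ?rnorm_ge0//.
by rewrite mulrC; exact: Tk.
Qed.

(* Uniform boundedness by a gliding hump: if [star T] is unbounded, pick [v n]
   with [u n := star T (v n)] larger than [n * 3 ^ n * rnorm (v n)], and move
   by [3 ^- n] along [+- u n] so that the limit [x] keeps
   [<v n, T x> = <u n, x>] of size at least [3 ^- n * rnorm (u n) / 2]. *)
Lemma bounded_by_exists T : exists2 k, 0 <= k & bounded_by T k.
Proof.
suff {T} bnd T : exists2 k, 0 <= k & bounded_by (star T) k.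
  by rewrite -(starK T); exact: bnd.
apply: contrapT => unbnd.
have /choice[v vP] n :
    exists v : H, n%:R * 3 ^+ n * rnorm v < rnorm (star T v).
  apply: contrapT => /forallNP bnd; apply: unbnd.
  exists (n%:R * 3 ^+ n); first by rewrite mulr_ge0 ?exprn_ge0.
  by move=> x; rewrite leNgt; apply/negP/bnd.
pose u n := star T (v n).
have u0 n : 0 < rnorm (u n).
  by apply: le_lt_trans (vP n); rewrite !mulr_ge0 ?exprn_ge0 ?rnorm_ge0.
pose s n : R := 3 ^- n / rnorm (u n).
have s0 n : 0 < s n by rewrite divr_gt0 ?invr_gt0 ?exprn_gt0.
have /choice[g gP] (p : nat * H) : exists y : H,
    rnorm (y - p.2) <= 3 ^- p.1 /\
    3 ^- p.1 * rnorm (u p.1) <= rnorm (inner (u p.1) y : A).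
  case: p => n x /=.
  have su : rnorm ((s n)%:C *: u n) = 3 ^- n.
    by rewrite rnormZ gtr0_norm// divfK// gt_eqF.
  have isu : rnorm (inner (u n) ((s n)%:C *: u n) : A) = 3 ^- n * rnorm (u n).
    rewrite innerZr rnormZ rnorm_inner gtr0_norm// expr2 mulrA divfK//.
    by rewrite gt_eqF.
  (* The inner products of [u n] with the two candidates differ by twice the threshold
     [3 ^- n * rnorm (u n)], so one of them reaches it. *)
  have [le1|lt1] := leP (3 ^- n * rnorm (u n))
      (rnorm (inner (u n) (x + (s n)%:C *: u n) : A)).
    by exists (x + (s n)%:C *: u n); rewrite addrAC subrr add0r su.
  exists (x - (s n)%:C *: u n).
  rewrite addrAC subrr add0r rnormN su; split=> //.
  have := ler_rnormB (inner (u n) (x + (s n)%:C *: u n) : A)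
                    (inner (u n) (x - (s n)%:C *: u n)).
  rewrite -innerBr opprB addrC addrA subrK innerDr.
  set w := inner _ ((s n)%:C *: u n) in isu *.
  by rewrite rnorm_double isu => le_sum; move: lt1 le_sum; lra.
pose x := fix x n := if n is m.+1 then g (m, x m) else 0.
(* [e n] is minus the sum of [3 ^- m] over [m >= n], so [x n.+1] lies within [3 ^- n / 2] of the
   limit. *)
pose e n : R := - (3 / 2) * 3 ^- n.
have e0 : e @ \oo --> (0 : R).
  rewrite -(mulr0 (- (3 / 2))); apply: cvgMr.
  rewrite (_ : (fun n => _) = (fun n => 3^-1 ^+ n)).
    by apply: cvg_expr; rewrite ger0_norm// invf_lt1//; lra.
  by apply/funext => n; rewrite exprVn.
have [|y yx] := @complete_majorized _ H x e 0 e0.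
  move=> n; rewrite /=; have [+ _] := gP (n, x n) => /= /le_trans; apply.
  by rewrite /e exprSr invfM; lra.
have [n] : exists n : nat, 2 * rnorm (T y) <= n%:R.
  exists (Num.truncn (2 * rnorm (T y))).+1; exact/ltW/truncnS_gt.
move=> ny; have := vP n; apply/negP; rewrite -leNgt -/(u n).
have [_ /=] := gP (n, x n); rewrite -[g _]/(x n.+1) => large.
have Tn0 : 0 < (3 : R) ^- n by rewrite invr_gt0 exprn_gt0.
have tail : rnorm (inner (u n) (y - x n.+1) : A) <= rnorm (u n) * (3 ^- n / 2).
  apply: le_trans (cs _ _) _; rewrite ler_wpM2l ?rnorm_ge0//.
  by apply: le_trans (yx _) _; rewrite /e exprSr invfM; lra.
have big : 3 ^- n * rnorm (u n) <= 2 * rnorm (inner (u n) y : A).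
  have : rnorm (inner (u n) (x n.+1) : A) <=
      rnorm (inner (u n) y : A) + rnorm (inner (u n) (y - x n.+1) : A).
    by rewrite -[X in inner _ X](subKr y) innerBr ler_rnormB.
  by move: large tail; lra.
have : rnorm (inner (u n) y : A) <= rnorm (v n) * rnorm (T y).
  by rewrite inner_starl; exact: cs.
have : rnorm (v n) * (2 * rnorm (T y)) <= rnorm (v n) * n%:R.
  by rewrite ler_wpM2l ?rnorm_ge0.
move=> h1 h2; have {}big : 3 ^- n * rnorm (u n) <= rnorm (v n) * n%:R by lra.
rewrite -(ler_pM2l Tn0); apply: le_trans big _.
rewrite mulrA (mulrC n%:R) mulrA mulVf ?lt0r_neq0 ?exprn_gt0// mul1r mulrC.
exact: lexx.
Qed.

(** The adjoints [star (F n)] converge with the same majorant, and the pointwise limits of the two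
    sequences are adjoint to each other. *)
Lemma op_complete (F : nat -> 'L(H)) (e : nat -> R) (l : R) :
  e @ \oo --> l -> (forall n, e n <= e n.+1) ->
  (forall n, bounded_by (F n.+1 - F n) (e n.+1 - e n)) ->
  exists T, forall n, bounded_by (T - F n) (l - e n).
Proof.
move=> e_l e_nd Fe.
have lim (G : nat -> 'L(H)) :
    (forall n, bounded_by (G n.+1 - G n) (e n.+1 - e n)) ->
    exists f : H -> H, forall x n, rnorm (f x - G n x) <= (l - e n) * rnorm x.
  move=> Ge.
  have lim_x x :
      exists y : H, forall n, rnorm (y - G n x) <= (l - e n) * rnorm x.
    have [|n|y yP] := @complete_majorized _ H (G^~ x)
      (fun n => e n * rnorm x) (l * rnorm x).
    - by apply: cvgM => //; exact: cvg_cst.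
    - by rewrite -mulrBl; exact: Ge.
    - by exists y => n; rewrite mulrBl.
  by have [f fP] := choice lim_x; exists f.
have [f fP] := lim F Fe.
have [|g gP] := lim (fun n => star (F n)).
  move=> n /=; rewrite -starB; apply: bounded_star => //.
  by rewrite subr_ge0.
have fg : is_adjoint f g.
  move=> x y; apply/subr0_eq/rnorm_limit_eq0 => eps eps0.
  pose C := rnorm x * rnorm y.
  have C0 : 0 <= C by rewrite mulr_ge0 ?rnorm_ge0.
  have [N _ eN] : \forall n \near \oo, l - eps / (2 * (C + 1)) < e n.
    apply: (cvgr_gt l) => //; rewrite ltrBlDr ltrDl divr_gt0// mulr_gt0//.
    by lra.
  have {eN} := eN N (leqnn N); rewrite /= ltrBlDr -ltrBlDl => eN.
  have -> : inner (f x) y - inner x (g y) =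
      inner (f x - F N x) y - inner x (g y - star (F N) y) :> A.
    by rewrite innerBl innerBr inner_star opprB addrA subrK.
  apply: le_trans (ler_rnormB _ _) _.
  have -> : eps = eps / (2 * (C + 1)) * (2 * (C + 1)).
    by rewrite divfK// lt0r_neq0// mulr_gt0//; lra.
  set d := eps / _ in eN *.
  have dC : 0 <= d * C /\ 0 <= d.
    have : 0 <= d by rewrite divr_ge0 ?mulr_ge0//; lra.
    by move=> ?; split=> //; rewrite mulr_ge0.
  have h1 : rnorm (inner (f x - F N x) y : A) <= d * C.
    apply: le_trans (cs _ _) _; rewrite /C mulrA ler_wpM2r ?rnorm_ge0//.
    by apply: le_trans (fP x N) _; rewrite ler_wpM2r ?rnorm_ge0// ltW.
  have h2 : rnorm (inner x (g y - star (F N) y) : A) <= d * C.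
    apply: le_trans (cs _ _) _; rewrite /C mulrCA ler_wpM2l ?rnorm_ge0//.
    by apply: le_trans (gP y N) _; rewrite ler_wpM2r ?rnorm_ge0// ltW.
  by move: dC => []; lra.
by exists (AdjOp (ex_intro _ g fg)) => n x; exact: fP.
Qed.

End OperatorBounds.

(** * Positive operators and square roots *)

Section PositiveOperators.
Context (R : realType) (A : cstarAlgType R) (H : hilbertModType A).
Hypothesis cs : cauchy_schwarz H.
Implicit Types (a b c h s S T X Y Z : 'L(H)) (k t : R).
Local Notation one := (1 : 'L(H)).

Lemma op_half T : (2^-1 : R)%:C *: (T + T) = T.
Proof.
have -> : (2^-1 : R)%:C = 2^-1 :> R[i] by rewrite fmorphV /= rmorph_nat.
by rewrite -mulr2n -(scaler_nat 2 T) scalerA mulVf ?scale1r// pnatr_eq0.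
Qed.

Lemma star_scale1 t : star (t%:C *: (1 : 'L(H))) = t%:C *: (1 : 'L(H)).
Proof. by rewrite starZ_real star1. Qed.

Lemma op_comm_scale (c : R[i]) S T :
  GRing.comm S T -> GRing.comm (c *: S) T.
Proof. by move=> ST; rewrite /GRing.comm op_scaleAl op_scaleAr ST. Qed.

Lemma bounded_by_scale1 t : 0 <= t -> bounded_by (t%:C *: (1 : 'L(H))) t.
Proof.
move=> t0; rewrite -{2}(mulr1 t); apply: bounded_byZ => //.
exact: bounded_by1.
Qed.

(** Used to pass operator identities to the limit: for every [n] the residual is bounded by a
    multiple of the error [l - e n]. *)
Lemma bounded_by_cvg0 T k (e : nat -> R) (l : R) :
  0 <= k -> e @ \oo --> l ->
  (forall n, bounded_by T (k * (l - e n))) -> T = 0.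
Proof.
move=> k0 e_l Te; apply: bounded_by_eq0 => eps eps0.
have [N _ eN] : \forall n \near \oo, l - eps / (k + 1) < e n.
  by apply: (cvgr_gt l) => //; rewrite ltrBlDr ltrDl divr_gt0//; lra.
have {eN} := eN N (leqnn N); rewrite /= ltrBlDr -ltrBlDl => /ltW eN.
apply: bounded_by_ge (Te N) _; apply: le_trans (ler_wpM2l k0 eN) _.
rewrite mulrA ler_pdivrMr; last lra.
by rewrite mulrC ler_wpM2l// ?ltW//; lra.
Qed.

(* [Y = (X + Y ^ 2) / 2], solved by iteration from [0]: the scalar iteration
   for [X = 1] increases to a limit at most [1] and majorizes the steps. *)
Lemma sqrt_one_sub X : star X = X -> bounded_by X 1 ->
  exists Y, [/\ star Y = Y, bounded_by Y 1, (1 - Y) * (1 - Y) = 1 - X &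
                forall Z, GRing.comm X Z -> GRing.comm Y Z].
Proof.
move=> sX X1.
pose y := fix y n : R := if n is m.+1 then (1 + y m ^+ 2) / 2 else 0.
pose F := fix F n : 'L(H) :=
  if n is m.+1 then (2^-1 : R)%:C *: (X + F m * F m) else 0.
have FS n : F n.+1 = (2^-1 : R)%:C *: (X + F n * F n) by [].
have yS n : y n.+1 = (1 + y n ^+ 2) / 2 by [].
have y01 n : 0 <= y n <= 1 by elim: n => [|n /andP[]] /=; nra.
have y_nd n : y n <= y n.+1.
  by rewrite -subr_ge0 /=; have := sqr_ge0 (1 - y n); lra.
have y_cvg : y @ \oo --> limn y.
  apply: nondecreasing_is_cvgn; first exact/nondecreasing_seqP.
  by exists 1 => _ [n _ <-]; case/andP: (y01 n).
set l := limn y in y_cvg.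
have yl n : y n <= l.
  apply: nondecreasing_cvgn_le; first exact/nondecreasing_seqP.
  by apply/cvg_ex; exists l.
have l1 : l <= 1.
  apply: limr_le; first by apply/cvg_ex; exists l.
  by apply: nearW => n; case/andP: (y01 n).
have half0 : 0 <= 2^-1 :> R by rewrite invr_ge0.
have Fy n : bounded_by (F n) (y n).
  elim: n => [|n IHn] /=; first exact: bounded_by0.
  rewrite mulrC; apply: bounded_byZ => //; apply: bounded_byD => //.
  by rewrite expr2; apply: bounded_byM => //; case/andP: (y01 n).
have dF n : bounded_by (F n.+1 - F n) (y n.+1 - y n).
  elim: n => [|n IHn].
    have -> : y 1 - y 0 = 2^-1 * 1 by rewrite /=; field.
    by rewrite /= mulr0 addr0 subr0; exact: bounded_byZ.
  (* A difference of squares split without commutativity; [y] obeys the same split, so the bounds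
     match term by term. *)
  have -> : F n.+2 - F n.+1 =
      (2^-1 : R)%:C *: (F n.+1 * (F n.+1 - F n) + (F n.+1 - F n) * F n).
    by rewrite FS [X in _ - X]FS -scalerBr; congr (_ *: _); ncring.
  have -> : y n.+2 - y n.+1 =
      2^-1 * (y n.+1 * (y n.+1 - y n) + (y n.+1 - y n) * y n).
    by rewrite yS [X in _ - X]yS; field.
  apply: bounded_byZ => //; apply: bounded_byD; apply: bounded_byM => //.
    by case/andP: (y01 n.+1).
  by rewrite subr_ge0.
have [Y YF] := op_complete cs y_cvg y_nd dF.
have Y1 : bounded_by Y 1.
  by have := YF 0; rewrite /= !subr0 => Yl; exact: bounded_by_ge l1.
have sF n : star (F n) = F n.
  elim: n => [|n IHn]; first exact: star0.
  by rewrite /= starZ_real starD starM IHn sX.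
have Y_fix : Y + Y = X + Y * Y.
  apply/subr0_eq/(@bounded_by_cvg0 _ 4 y l) => // n.
  have -> : Y + Y - (X + Y * Y) = (Y - F n.+1) + (Y - F n.+1)
      - (Y * (Y - F n) + (Y - F n) * F n).
    have -> : X = F n.+1 + F n.+1 - F n * F n.
      by rewrite /= -scalerDr op_half addrK.
    ncring.
  have -> : 4 * (l - y n) =
      (l - y n) + (l - y n) + (1 * (l - y n) + (l - y n) * 1) by ring.
  have bS : bounded_by (Y - F n.+1) (l - y n).
    by apply: bounded_by_ge (YF _) _; rewrite lerD2l lerN2.
  apply: bounded_byD; first exact: bounded_byD.
  apply/bounded_byN/bounded_byD; first exact: bounded_byM.
  apply: bounded_byM; rewrite ?subr_ge0//.
  by apply: bounded_by_ge (Fy n) _; case/andP: (y01 n).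
have sY : star Y = Y.
  apply/subr0_eq/(@bounded_by_cvg0 _ 2 y l) => // n.
  have -> : star Y - Y = star (Y - F n) - (Y - F n).
    by rewrite starB sF; ncring.
  have -> : 2 * (l - y n) = (l - y n) + (l - y n) by ring.
  apply: bounded_byD; last exact: bounded_byN.
  by apply: bounded_star; rewrite ?subr_ge0.
exists Y; split=> //.
  have -> : (1 - Y) * (1 - Y) = 1 - (Y + Y) + Y * Y by ncring.
  by rewrite Y_fix; ncring.
move=> Z XZ; have FZ n : GRing.comm (F n) Z.
  elim: n => [|n IHn]; first exact/commr_sym/commr0.
  apply: op_comm_scale; apply/commr_sym/commrD; first exact: commr_sym.
  by apply: commrM; exact: commr_sym.
have [k k0 Zk] := bounded_by_exists cs Z.
apply/subr0_eq/(@bounded_by_cvg0 _ (k + k) y l) => //; first exact: addr_ge0.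
move=> n; have -> : Y * Z - Z * Y = (Y - F n) * Z - Z * (Y - F n).
  by rewrite mulrBl mulrBr (FZ n); ncring.
have -> : (k + k) * (l - y n) = (l - y n) * k + k * (l - y n) by ring.
apply: bounded_byD; first by apply: bounded_byM; rewrite ?subr_ge0.
by apply/bounded_byN/bounded_byM.
Qed.

(* Equivalent to the spectrum of [a] being nonnegative, but additive by the
   triangle inequality. *)
Definition op_pos a :=
  star a = a /\ exists2 t, 0 <= t & bounded_by (t%:C *: one - a) t.

Lemma op_pos_ge a : op_pos a ->
  exists2 t, 0 <= t & forall k, t <= k -> bounded_by (k%:C *: one - a) k.
Proof.
move=> [_ [t t0 ta]]; exists t => // k tk.
have -> : k%:C *: one - a = (k - t)%:C *: (1 : 'L(H)) + (t%:C *: one - a).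
  by rewrite addrA -scalerDl -rmorphD /= subrK.
rewrite -{2}(subrK t k); apply: bounded_byD => //.
by apply: bounded_by_scale1; rewrite subr_ge0.
Qed.

Lemma op_pos_gt0 a :
  op_pos a -> exists2 t, 0 < t & bounded_by (t%:C *: one - a) t.
Proof.
by move=> /op_pos_ge[t t0 ta]; exists (t + 1); [lra|apply: ta; lra].
Qed.

Lemma op_posD a b : op_pos a -> op_pos b -> op_pos (a + b).
Proof.
move=> [sa [t t0 ta]] [sb [k k0 kb]]; split; first by rewrite starD sa sb.
exists (t + k); first exact: addr_ge0.
by rewrite rmorphD /= scalerDl opprD addrACA; exact: bounded_byD.
Qed.

(** Here [a = t (1 - X)] with [X] bounded by 1, and the root is [sqrt t (1 - Y)]; it is positive
    since [sqrt t] minus it is [sqrt t Y]. The commutation clause drives uniqueness of roots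
    below. *)
Lemma op_pos_sqrt a : op_pos a ->
  exists s, [/\ op_pos s, s * s = a &
                forall Z, GRing.comm a Z -> GRing.comm s Z].
Proof.
move=> pa; have [sa _] := pa; have [t t0 ta] := op_pos_gt0 pa.
pose X := t^-1%:C *: (t%:C *: one - a).
have tI : t%:C * t^-1%:C = 1 by rewrite -rmorphM /= divff ?gt_eqF.
have [||Y [sY Y1 YX Ycomm]] := @sqrt_one_sub X.
- by rewrite starZ_real starB star_scale1 sa.
- rewrite -(mulVf (lt0r_neq0 t0)).
  by apply: bounded_byZ; rewrite ?invr_ge0 ?ltW.
have aE : a = t%:C *: (1 - X).
  by rewrite scalerBr scalerA tI scale1r opprB addrC subrK.
have tt : (Num.sqrt t)%:C * (Num.sqrt t)%:C = t%:C.
  by rewrite -rmorphM /= -expr2 sqr_sqrtr ?ltW.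
exists ((Num.sqrt t)%:C *: (1 - Y)); split.
- split; first by rewrite starZ_real starB star1 sY.
  exists (Num.sqrt t); first exact: sqrtr_ge0.
  rewrite scalerBr opprB addrC subrK -{2}(mulr1 (Num.sqrt t)).
  by apply: bounded_byZ => //; exact: sqrtr_ge0.
- by rewrite op_scaleAl op_scaleAr scalerA tt YX -aE.
- move=> Z aZ; apply/op_comm_scale/commr_sym/commrB; first exact: commr1.
  apply/commr_sym/Ycomm/op_comm_scale/commr_sym/commrB; last exact: commr_sym.
  exact/commr_sym/op_comm_scale/commr_sym/commr1.
Qed.

(* [b + i c] is [sqrt t] times an isometry, and so is its adjoint [b - i c]. *)
Lemma bounded_by_add_sqr b c t : 0 <= t -> star b = b -> star c = c ->
  GRing.comm b c -> b * b + c * c = t%:C *: one -> bounded_by c (Num.sqrt t).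
Proof.
move=> t0 sb sc bc bct; pose U := b + 'i *: c.
have sU : star U = b - 'i *: c.
  by rewrite starD starZ sb sc complex_conji scaleNr.
have U1 : bounded_by U (Num.sqrt t).
  apply: bounded_isometry => //; rewrite -bct sU.
  rewrite mulrBl !mulrDr !op_scaleAl !op_scaleAr scalerA complex_mulii.
  rewrite scaleN1r bc.
  by rewrite opprD opprK addrA addrK.
have := bounded_byD U1 (bounded_byN (bounded_star cs (sqrtr_ge0 t) U1)).
rewrite sU opprB addrC addrA subrK => cc x.
have := cc x; rewrite opE rnorm_double opE rnormZi mulrDl; lra.
Qed.

(** After scaling by a bound [k > 0] of [a], the identity [X ^ 2 + (1 - Y) ^ 2 = 1] makes [1 - Y]
    bounded by 1, and [k ^ 2 - a ^ 2] is [k ^ 2 (1 - Y) ^ 2]. *)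
Lemma op_pos_sqr a : star a = a -> op_pos (a * a).
Proof.
move=> sa; split; first by rewrite starM sa.
have [k0 k0_ge0 ak0] := bounded_by_exists cs a; pose k := k0 + 1.
have k_gt0 : 0 < k by rewrite /k; lra.
have ak : bounded_by a k by apply: bounded_by_ge ak0 _; rewrite /k; lra.
pose X := k^-1%:C *: a.
have X1 : bounded_by X 1.
  rewrite -(mulVf (lt0r_neq0 k_gt0)).
  by apply: bounded_byZ; rewrite ?invr_ge0 ?ltW.
have sX : star X = X by rewrite starZ_real sa.
have [||Y [sY _ YX Ycomm]] := @sqrt_one_sub (X * X).
- by rewrite starM sX.
- by rewrite -(mulr1 1); exact: bounded_byM.
have bY : bounded_by (1 - Y) 1.
  rewrite -sqrtr1; apply: (@bounded_by_add_sqr X) => //.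
  - by rewrite starB star1 sY.
  - by apply: commrB; [exact: commr1|apply/commr_sym/Ycomm/commr_sym/commrM].
  - by rewrite YX scale1r addrC subrK.
exists (k * k); first by rewrite mulr_ge0 ?ltW.
have -> : (k * k)%:C *: one - a * a = (k * k)%:C *: ((1 - Y) * (1 - Y)).
  rewrite YX scalerBr /X op_scaleAl op_scaleAr !scalerA -!rmorphM /=.
  rewrite (_ : k * k * (k^-1 * k^-1) = 1) ?scale1r//.
  by field; exact: lt0r_neq0.
rewrite -[X in bounded_by _ X]mulr1; apply: bounded_byZ.
  by rewrite mulr_ge0 ?ltW.
by rewrite -[X in bounded_by _ X](mulr1 1); exact: bounded_byM.
Qed.

(** The roots [b] of [a] and [c] of [- a] commute and [b ^ 2 + c ^ 2 = 0], so [c] is bounded by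
    0. *)
Lemma op_pos_antisym a : op_pos a -> op_pos (- a) -> a = 0.
Proof.
move=> pa pna.
have [b [[sb _] bb bcomm]] := op_pos_sqrt pa.
have [c [[sc _] cc ccomm]] := op_pos_sqrt pna.
have bc : GRing.comm b c.
  by apply/bcomm/commr_sym/ccomm/commr_sym/commrN.
suff c0 : c = 0 by rewrite -(opprK a) -cc c0 mulr0 oppr0.
apply: bounded_by_eq0 => e e0; apply: bounded_by_ge (ltW e0).
rewrite -sqrtr0; apply: (bounded_by_add_sqr _ sb) => //.
by rewrite bb cc subrr scale0r.
Qed.

(** The roots of [t - a] and of [a] commute, and their squares add up to [t]. *)
Lemma op_pos_le_bounded a t : 0 <= t ->
  op_pos a -> op_pos (t%:C *: one - a) -> bounded_by a t.
Proof.
move=> t0 pa pta.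
have [b [[sb _] bb bcomm]] := op_pos_sqrt pta.
have [c [[sc _] cc ccomm]] := op_pos_sqrt pa.
have ct : bounded_by c (Num.sqrt t).
  apply: (bounded_by_add_sqr t0 sb sc); last by rewrite bb cc subrK.
  apply/bcomm/commr_sym/commrB; last exact/ccomm.
  exact/commr_sym/op_comm_scale/commr_sym/commr1.
rewrite -cc -(sqr_sqrtr t0) expr2; apply: bounded_byM => //; exact: sqrtr_ge0.
Qed.

Lemma starX T n : star (T ^+ n) = star T ^+ n.
Proof.
by elim: n => [|n IHn]; rewrite ?expr0 ?star1// exprS starM IHn -exprSr.
Qed.

Lemma bounded_byX T k n :
  0 <= k -> bounded_by T k -> bounded_by (T ^+ n) (k ^+ n).
Proof.
move=> k0 Tk; elim: n => [|n IHn]; first by rewrite !expr0; exact: bounded_by1.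
by rewrite !exprS; exact: bounded_byM.
Qed.

(** [bounded_cstar] applied to successive squares of a selfadjoint operator. *)
Lemma bounded_by_exp2 a k m : 0 <= k -> star a = a ->
  bounded_by (a ^+ (2 ^ m)) (k ^+ (2 ^ m)) -> bounded_by a k.
Proof.
move=> k0 sa; elim: m => [|m IHm]; first by rewrite expn0 !expr1.
rewrite expnSr !exprM => am; apply/IHm/(bounded_cstar cs).
  exact: exprn_ge0.
by rewrite starX sa.
Qed.

(** Bernoulli's inequality for the exponent [2 ^ j], squared: the term [(2 ^ j * k) ^ 2] dominates
    [2 ^ j * 2 C] once [j] exceeds [2 C / k ^ 2]. *)
Lemma linear_le_exp2 k C :
  0 < k -> exists m, 1 + (2 ^ m)%:R * C <= (1 + k) ^+ (2 ^ m).
Proof.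
move=> k0.
have bern n : 1 + n%:R * k <= (1 + k) ^+ n.
  elim: n => [|n IHn]; first by rewrite mul0r addr0 expr0.
  rewrite exprS -natr1; have n0 : 0 <= n%:R :> R by [].
  apply: le_trans (ler_wpM2l (addr_ge0 ler01 (ltW k0)) IHn).
  by have := mulr_ge0 n0 (sqr_ge0 k); lra.
pose j := (Num.truncn (2 * C / k ^+ 2)).+1.
have jC : 2 * C <= j%:R * k ^+ 2.
  by rewrite -ler_pdivrMr ?exprn_gt0//; exact/ltW/truncnS_gt.
have j2 : j%:R <= (2 ^ j)%:R :> R by rewrite ler_nat ltnW// ltn_expl.
exists j.+1; rewrite expnSr exprM.
have N0 : 0 <= (2 ^ j)%:R :> R by [].
move: (bern (2 ^ j)%N) N0 j2; rewrite natrM; set N := (2 ^ j)%:R => NB N0 jN.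
have {}jC : 2 * C <= N * k ^+ 2.
  by apply: le_trans jC _; rewrite ler_wpM2r ?sqr_ge0.
have : (1 + N * k) ^+ 2 <= ((1 + k) ^+ (2 ^ j)) ^+ 2.
  have Nk0 : 0 <= 1 + N * k by rewrite addr_ge0// mulr_ge0// ltW.
  by rewrite ler_pXn2r ?nnegrE// (le_trans Nk0).
apply: le_trans; have := ler_wpM2l N0 jC; have := mulr_ge0 N0 (ltW k0); nra.
Qed.

(* With [a = t + S S^*] and [b = t + S^* S], [a ^+ n * S = S * b ^+ n] shows
   that [a ^+ n] is bounded by a multiple of [n * t ^+ n]; as [a] is selfadjoint,
   this forces the bound [t] on [a] itself. *)
Lemma bounded_by_flip S t : 0 < t ->
  bounded_by (t%:C *: one + star S * S) t ->
  bounded_by (t%:C *: one + S * star S) t.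
Proof.
move=> t0; set a := _ + S * star S; set b := _ + star S * S => bt.
have [k k0 Sk] := bounded_by_exists cs S.
have sa : star a = a by rewrite starD starM starK star_scale1.
have ab : a * S = S * b.
  by rewrite mulrDl mulrDr op_scaleAl op_scaleAr mul1r mulr1 mulrA.
have aS n : a ^+ n * S = S * b ^+ n.
  elim: n => [|n IHn]; first by rewrite !expr0 mul1r mulr1.
  by rewrite exprSr -mulrA ab mulrA IHn -mulrA -exprSr.
pose C := k * k / t.
have an n : bounded_by (a ^+ n) (t ^+ n * (1 + n%:R * C)).
  elim: n => [|n IHn].
    by rewrite !expr0 mul0r addr0 mulr1; exact: bounded_by1.
  have -> : a ^+ n.+1 = t%:C *: a ^+ n + S * b ^+ n * star S.
    by rewrite exprSr mulrDr op_scaleAr mulr1 mulrA aS.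
  have -> : t ^+ n.+1 * (1 + n.+1%:R * C) =
      t * (t ^+ n * (1 + n%:R * C)) + k * t ^+ n * k.
    by rewrite exprS -natr1 /C; field; exact: lt0r_neq0.
  apply: bounded_byD; first by apply: bounded_byZ => //; exact: ltW.
  apply: bounded_byM; last exact: bounded_star.
    by rewrite mulr_ge0// exprn_ge0// ltW.
  by apply: bounded_byM => //; apply: bounded_byX => //; exact: ltW.
apply: bounded_by_limit => e e0.
have [m mP] := linear_le_exp2 C (divr_gt0 e0 t0).
apply: (@bounded_by_exp2 _ _ m) => //; first by lra.
apply: bounded_by_ge (an _) _.
have -> : t + e = t * (1 + e / t) by field; exact: lt0r_neq0.
by rewrite exprMn ler_wpM2l// exprn_ge0// ltW.
Qed.

(** Takes the place of the equality of the nonzero spectra of [S^* S] and [S S^*]. *)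
Lemma op_pos_flip S : op_pos (- (star S * S)) -> op_pos (- (S * star S)).
Proof.
move=> /op_pos_gt0[t t0]; rewrite opprK => St.
split; first by rewrite starN starM starK.
by exists t; [exact: ltW|rewrite opprK; exact: bounded_by_flip].
Qed.

Lemma op_double_eq0 T : T + T = 0 -> T = 0.
Proof. by move=> TT; rewrite -(op_half T) TT scaler0. Qed.

Lemma op_cube_eq0 a : star a = a -> a * a * a = 0 -> a = 0.
Proof.
move=> sa a3; apply: star_mulr_eq0; rewrite sa; apply: star_mulr_eq0.
by rewrite starM sa mulrA a3 mul0r.
Qed.

(* Fukamiya's theorem. With [h = T^* T], [v = |h|] and [n = v - h] (twice the
   negative part), [S = T n] has [S^* S = - n v n <= 0], hence [S S^* <= 0];
   but [S^* S + S S^*] is half a sum of two squares, so [S^* S = 0]. *)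
Theorem op_pos_star_mul T : op_pos (star T * T).
Proof.
set h := star T * T; have sh : star h = h by rewrite starM starK.
have [v [pv vv vcomm]] := op_pos_sqrt (op_pos_sqr sh).
have [sv _] := pv.
have [w [[sw _] ww wcomm]] := op_pos_sqrt pv.
pose n := v - h; have sn : star n = n by rewrite starB sv sh.
have vh : GRing.comm v h by apply/vcomm/commr_sym/commrM.
have vn : GRing.comm v n by exact: commrB.
have wn : GRing.comm w n by exact: wcomm.
have hnv : h * n = - (v * n).
  by rewrite /n !mulrBr vv vh; ncring.
have SSn : star (T * n) * (T * n) = - (w * n * (w * n)).
  rewrite starM sn -(mulrA n) (mulrA (star T)) -/h hnv mulrN.
  by rewrite {1}wn -(mulrA n) (mulrA w) ww.
have pn : op_pos (w * n * (w * n)).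
  by apply: op_pos_sqr => //; rewrite starM sw sn -wn.
set S := T * n in SSn.
have pflip : op_pos (- (S * star S)) by apply: op_pos_flip; rewrite SSn opprK.
pose q := 'i *: (S - star S).
have sq : star q = q.
  by rewrite starZ complex_conji starB starK scaleNr -scalerN opprB.
have sp : star (S + star S) = S + star S by rewrite starD starK addrC.
have pq : op_pos (star S * S + star S * S).
  have -> : star S * S + star S * S =
      (S + star S) * (S + star S) + q * q + (- (S * star S) + - (S * star S)).
    rewrite op_scaleAl op_scaleAr scalerA complex_mulii scaleN1r; ncring.
  by apply: op_posD; apply: op_posD => //; exact: op_pos_sqr.
have SS0 : star S * S = 0.
  apply/op_double_eq0/op_pos_antisym => //.
  by rewrite SSn -opprD opprK; exact: op_posD.
(* [S^* S] is [n h n], and [h n = - v n]; so [n v n] and [n h n] both vanish, and their difference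
   is [n ^ 3]. *)
have nhn : n * h * n = 0.
  by rewrite -[RHS]SS0 starM sn !mulrA.
have nvn : n * v * n = 0.
  by rewrite -mulrA -[v * n]opprK -hnv mulrN mulrA nhn oppr0.
have n0 : n = 0.
  apply: op_cube_eq0 => //.
  by rewrite -[RHS](subrr 0) -{1}nvn -nhn -mulrBl -mulrBr.
by have /subr0_eq <- : v - h = 0 by exact: n0.
Qed.

(** The Neumann series, with partial sums [F n]; [e n] is minus the tail [k ^ n / (1 - k)] of the
    geometric series. *)
Lemma op_neumann X k : 0 <= k < 1 -> bounded_by X k ->
  exists Y, (1 - X) * Y = 1 /\ Y * (1 - X) = 1.
Proof.
move=> /andP[k0 k1] Xk; have k1' : 0 < 1 - k by lra.
pose F := fix F n := if n is m.+1 then F m + X ^+ m else 0 : 'L(H).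
pose e n : R := - (k ^+ n / (1 - k)).
have e0 : e @ \oo --> (0 : R).
  rewrite -oppr0; apply: cvgN; rewrite -(mul0r (1 - k)^-1).
  by apply: cvgMl; apply: cvg_expr; rewrite ger0_norm.
have e_incr n : e n.+1 - e n = k ^+ n.
  by rewrite /e exprS; field; exact: lt0r_neq0.
have [||Y YF] := op_complete cs e0 (F := F).
- by move=> n; rewrite -subr_ge0 e_incr exprn_ge0.
- by move=> n; rewrite e_incr /= addrAC subrr add0r; exact: bounded_byX.
have XF n : (1 - X) * F n = 1 - X ^+ n.
  elim: n => [|n IHn]; first by rewrite mulr0 expr0 subrr.
  by rewrite /= mulrDr IHn exprS; ncring.
have FX n : F n * (1 - X) = 1 - X ^+ n.
  elim: n => [|n IHn]; first by rewrite mul0r expr0 subrr.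
  by rewrite /= mulrDl IHn exprSr; ncring.
have X1 : bounded_by (1 - X) (1 + k).
  by apply: bounded_byD; [exact: bounded_by1|exact: bounded_byN].
have e_neg n : 0 - e n = k ^+ n / (1 - k) by rewrite /e sub0r opprK.
have kn0 n : 0 <= k ^+ n / (1 - k) by rewrite divr_ge0// ?exprn_ge0// ltW.
have kn n : k ^+ n <= k ^+ n / (1 - k).
  by rewrite ler_peMr ?exprn_ge0// invf_ge1//; lra.
(* The residual is at most [1 + k] tails plus [k ^ n], hence at most 3 tails since [k < 1]. *)
exists Y; split; apply/subr0_eq/(@bounded_by_cvg0 _ 3 e 0) => // n.
  have -> : (1 - X) * Y - 1 = (1 - X) * (Y - F n) - X ^+ n.
    by rewrite mulrBr XF; ncring.
  apply: (@bounded_by_ge _ _ _ _ ((1 + k) * (0 - e n) + k ^+ n)).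
    apply: bounded_byD; first by apply: bounded_byM => //; lra.
    by apply/bounded_byN/bounded_byX.
  by rewrite e_neg; move: (kn n) (kn0 n) k1; nra.
have -> : Y * (1 - X) - 1 = (Y - F n) * (1 - X) - X ^+ n.
  by rewrite mulrBl FX; ncring.
apply: (@bounded_by_ge _ _ _ _ ((0 - e n) * (1 + k) + k ^+ n)).
  apply: bounded_byD; first by apply: bounded_byM => //; rewrite e_neg.
  by apply/bounded_byN/bounded_byX.
by rewrite e_neg; move: (kn n) (kn0 n) k1; nra.
Qed.

(** [1 + h] is [1 + t] times [1 - (t - h) / (1 + t)], and [(t - h) / (1 + t)] is bounded by
    [t / (1 + t) < 1]. *)
Lemma op_pos_one_add_inv h : op_pos h ->
  exists g, (1 + h) * g = 1 /\ g * (1 + h) = 1.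
Proof.
move=> /op_pos_gt0[t t0 th]; have t1 : 0 < 1 + t by lra.
pose r : R := (1 + t)^-1.
have r0 : 0 <= r by rewrite invr_ge0 ltW.
have [||Y [XY YX]] := @op_neumann (r%:C *: (t%:C *: one - h)) (r * t).
- by rewrite mulr_ge0 ?(ltW t0)//= mulrC ltr_pdivrMr// mul1r; lra.
- by apply: bounded_byZ.
have rt1 : r%:C *: ((1 + t)%:C *: one) = one.
  by rewrite scalerA -rmorphM /= mulVf ?scale1r// lt0r_neq0.
have hE : 1 - r%:C *: (t%:C *: one - h) = r%:C *: (1 + h).
  rewrite -{1}rt1 -scalerBr; congr (_ *: _).
  by rewrite rmorphD /= scalerDl scale1r; ncring.
exists (r%:C *: Y); split; first by rewrite op_scaleAr -op_scaleAl -hE XY.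
by rewrite op_scaleAl -op_scaleAr -hE YX.
Qed.

(** Each root [c] is compared with the root [s] from [op_pos_sqrt], which commutes with everything
    that commutes with [s ^ 2 = c ^ 2], hence with [c]. For [d = c - s], the positive operators
    [d c d] and [d s d] have sum 0, so both vanish and [d ^ 3 = 0]. *)
Lemma op_pos_sqrt_unique a b : op_pos a -> op_pos b -> a * a = b * b -> a = b.
Proof.
move=> pa pb ab.
have [s [ps sab scomm]] := op_pos_sqrt (op_pos_sqr pb.1).
suff sqrt_eq c : op_pos c -> c * c = s * s -> c = s.
  by rewrite (sqrt_eq a pa (etrans ab (esym sab))) (sqrt_eq b pb (esym sab)).
move=> pc cs2; have sc : GRing.comm s c.
  by apply/scomm; rewrite -sab -cs2; apply/commr_sym/commrM.
have [r [[sr _] rr _]] := op_pos_sqrt pc.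
have [u [[su _] uu _]] := op_pos_sqrt ps.
pose d := c - s; have sd : star d = d by rewrite starB pc.1 ps.1.
have dcs : d * c * d + d * s * d = 0.
  rewrite -mulrDl -mulrDr (_ : d * (c + s) = 0) ?mul0r//.
  by rewrite mulrDr !mulrBl cs2 sc; ncring.
have conj_pos x y : star x = x -> x * x = y -> op_pos (d * y * d).
  move=> sx <-; rewrite mulrA -mulrA -{1}sd -{1}sx -starM.
  exact: op_pos_star_mul.
have dsdN : - (d * c * d) = d * s * d.
  by apply/eqP; rewrite eq_sym -addr_eq0 addrC dcs.
have dcd : d * c * d = 0.
  apply: op_pos_antisym => //; first exact: conj_pos rr.
  by rewrite dsdN; exact: conj_pos uu.
have dsd : d * s * d = 0 by rewrite -dcs dcd add0r.
apply/subr0_eq/op_cube_eq0 => //.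
by rewrite -[RHS](subrr 0) -{1}dcd -dsd -mulrBl -mulrBr.
Qed.

End PositiveOperators.

(** * The Cauchy-Schwarz inequality *)

Definition regular_module (R : realType) (A : cstarAlgType R) : Type := A.

Section RegularModule.
Context (R : realType) (A : cstarAlgType R).
Local Notation M := (regular_module A).
Implicit Types a b u v w : A.

HB.instance Definition _ := CompleteNormedModule.copy M A.

Definition regular_act (x : M) (a : A) : M := amul (x : A) a.
Definition regular_inner (x y : M) : A := amul (astar (x : A)) (y : A).

Fact regular_actDl (x y : M) a :
  regular_act (x + y) a = regular_act x a + regular_act y a.
Proof. exact: amulDl. Qed.

Fact regular_actDr (x : M) a b :
  regular_act x (a + b) = regular_act x a + regular_act x b.
Proof. exact: amulDr. Qed.

Fact regular_actA (x : M) a b :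
  regular_act (regular_act x a) b = regular_act x (amul a b).
Proof. by rewrite /regular_act amulA. Qed.

Fact regular_actZl (c : R[i]) (x : M) a :
  regular_act (c *: x) a = c *: regular_act x a.
Proof. exact: amulZl. Qed.

Fact regular_actZr (c : R[i]) (x : M) a :
  regular_act x (c *: a) = c *: regular_act x a.
Proof. exact: amulZr. Qed.

Fact regular_innerDr (x y z : M) :
  regular_inner x (y + z) = regular_inner x y + regular_inner x z.
Proof. exact: amulDr. Qed.

Fact regular_innerZr (c : R[i]) (x y : M) :
  regular_inner x (c *: y) = c *: regular_inner x y.
Proof. exact: amulZr. Qed.

Fact regular_inner_act (x y : M) a :
  regular_inner x (regular_act y a) = amul (regular_inner x y) a.
Proof. by rewrite /regular_inner /regular_act amulA. Qed.

Fact regular_innerC (x y : M) : regular_inner y x = astar (regular_inner x y).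
Proof. by rewrite /regular_inner astarM astarK. Qed.

HB.instance Definition _ := Lmodule_isInnerModule.Build R A M
  regular_actDl regular_actDr regular_actA regular_actZl regular_actZr
  regular_innerDr regular_innerZr regular_inner_act regular_innerC.

Fact regular_inner_pos (x : M) : apos (inner x x : A).
Proof. by exists x. Qed.

Fact regular_norm_inner (x : M) : `|x| ^+ 2 = `|inner x x : A|.
Proof. exact/esym/(norm_cstar (x : A)). Qed.

Fact regular_inner_eq0 (x : M) : inner x x = 0 :> A -> x = 0.
Proof.
move=> x0; have := regular_norm_inner x; rewrite x0 normr0 => /eqP.
by rewrite expf_eq0 /= normr_eq0 => /eqP.
Qed.

HB.instance Definition _ := InnerModule_isHilbert.Build R A M
  regular_inner_pos regular_inner_eq0 regular_norm_inner.

Lemma rnorm_amul a b : rnorm (amul a b) <= rnorm a * rnorm b.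
Proof. by rewrite -lecR rmorphM /= -!rnormE; exact: ler_norm_amul. Qed.

Lemma rnorm_cstar a : rnorm (amul (astar a) a) = rnorm a ^+ 2.
Proof. by apply: complexI; rewrite rmorphXn /= -!rnormE norm_cstar. Qed.

Lemma rnorm_astar a : rnorm (astar a) = rnorm a.
Proof.
suff le b : rnorm b <= rnorm (astar b).
  by apply/eqP; rewrite eq_le le -{2}(astarK a) le.
have [->|b0] := eqVneq b 0; first by rewrite rnorm0 rnorm_ge0.
by rewrite -(ler_pM2r (rnorm_gt0 b0)) -expr2 -rnorm_cstar rnorm_amul.
Qed.

(** Makes the results on positive operators available for operators on [A]. *)
Lemma regular_cauchy_schwarz : cauchy_schwarz M.
Proof. by move=> x y; rewrite -[rnorm x]rnorm_astar; exact: rnorm_amul. Qed.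

Fact lmulop_adjoint a : is_adjoint (amul a : M -> M) (amul (astar a) : M -> M).
Proof. by move=> x y; rewrite /inner /= /regular_inner astarM amulA. Qed.

Fact lmulop_adjointable a : adjointable (amul a : M -> M).
Proof. by exists (amul (astar a)); exact: lmulop_adjoint. Qed.

(** The left regular representation: it carries [A], which may have no unit, into a unital ring
    where positivity has been developed. *)
Definition lmulop a : 'L(M) := AdjOp (lmulop_adjointable a).

Lemma star_lmulop a : star (lmulop a) = lmulop (astar a).
Proof. exact/star_unique/lmulop_adjoint. Qed.

Lemma lmulopM a b : lmulop (amul a b) = lmulop a * lmulop b.
Proof. by apply: adjOp_eqP => x; rewrite !opE /= amulA. Qed.

Lemma lmulopD a b : lmulop (a + b) = lmulop a + lmulop b.
Proof. by apply: adjOp_eqP => x; rewrite !opE /= amulDl. Qed.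

Lemma bounded_lmulop a : bounded_by (lmulop a) (rnorm a).
Proof. by move=> x; exact: rnorm_amul. Qed.

Lemma apos_lmulop u : apos u -> op_pos (lmulop u).
Proof.
move=> [b ->]; rewrite lmulopM -star_lmulop.
exact/op_pos_star_mul/regular_cauchy_schwarz.
Qed.

(** With [t] the norm of [u + w], [t - u] is the sum of the positive [t - (u + w)] and [w]. So left
    multiplication by [u] is bounded by [t], and its value at [u] has norm [rnorm u ^+ 2]. *)
Lemma rnorm_le_posD u w :
  op_pos (lmulop u) -> op_pos (lmulop w) -> rnorm u <= rnorm (u + w).
Proof.
move=> pu pw; set t := rnorm (u + w).
have t0 : 0 <= t by exact: rnorm_ge0.
have ptv : op_pos (t%:C *: (1 : 'L(M)) - lmulop (u + w)).
  split; first by rewrite starB star_scale1 lmulopD starD pu.1 pw.1.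
  by exists t => //; rewrite opprB addrC subrK; exact: bounded_lmulop.
have ut : bounded_by (lmulop u) t.
  apply: op_pos_le_bounded => //; first exact: regular_cauchy_schwarz.
  have -> : t%:C *: (1 : 'L(M)) - lmulop u =
      t%:C *: (1 : 'L(M)) - lmulop (u + w) + lmulop w.
    by rewrite lmulopD; ncring.
  exact: op_posD.
have [->|u0] := eqVneq u 0; first by rewrite rnorm0.
rewrite -(ler_pM2r (rnorm_gt0 u0)) -expr2 -rnorm_cstar.
by rewrite -[amul _ _]/(lmulop (astar u) u) -star_lmulop pu.1; exact: ut.
Qed.

End RegularModule.

Section CauchySchwarz.
Context (R : realType) (A : cstarAlgType R) (H : hilbertModType A).

(* With [a = <x, y>], [p = <x, x>], [z = x a - y] and [r ^ 2 = 1 - p],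
   [<y, y> = a^* a + <z, z> + (r a)^* (r a)] is a sum of positive elements. *)
Lemma rnorm_inner_unit (x y : H) :
  rnorm x = 1 -> rnorm (inner x y : A) <= rnorm y.
Proof.
move=> x1; set a : A := inner x y; set p : A := inner x x.
have pp : op_pos (lmulop p) by exact/apos_lmulop/inner_pos.
have p1 : rnorm p = 1 by rewrite rnorm_inner x1 expr1n.
have p1p : op_pos (1 - lmulop p).
  split; first by rewrite starB star1 pp.1.
  exists 1 => //; rewrite scale1r opprB addrC subrK -p1.
  exact: bounded_lmulop.
(* As [A] may have no unit, [1 - p] and its root are taken among the operators on [A]. *)
have [r [[sr _] rr _]] := op_pos_sqrt (@regular_cauchy_schwarz _ A) p1p.
pose z := hact x a - y.
pose g : A := r (a : regular_module A).
have gg : amul (astar g) g = amul (astar a) a - amul (astar a) (amul p a).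
  pose ra : regular_module A := r (a : regular_module A).
  rewrite -[amul _ g]/(inner ra ra) /ra.
  rewrite inner_star sr -[r (r _)]/((r * r) _) rr.
  by rewrite !opE innerBr.
have yy : inner y y = amul (astar a) a + (inner z z + amul (astar g) g) :> A.
  rewrite gg /z innerBl !innerBr !inner_actl !inner_act -/a -/p.
  rewrite (innerC x y) -/a.
  move: (amul (astar a) a) (amul (astar a) (amul p a)) => S T.
  rewrite (addrC (T - S - _)) opprB !addrA subrK addrK.
  by rewrite addrAC subrr add0r.
rewrite -(@ler_pXn2r _ 2) ?nnegrE ?rnorm_ge0// -rnorm_inner -rnorm_cstar yy.
apply: rnorm_le_posD; first by apply: apos_lmulop; exists a.
rewrite lmulopD; apply: op_posD; first exact/apos_lmulop/inner_pos.
by apply: apos_lmulop; exists g.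
Qed.

Theorem hilbert_cauchy_schwarz : cauchy_schwarz H.
Proof.
move=> x y; have [->|x0] := eqVneq x 0; first by rewrite inner0l !rnorm0 mul0r.
have rx0 := rnorm_gt0 x0.
have {1}-> : x = (rnorm x)%:C *: ((rnorm x)^-1%:C *: x).
  by rewrite scalerA -rmorphM /= divff ?scale1r// gt_eqF.
rewrite innerZl (_ : Num.conj _ = (rnorm x)%:C); last first.
  by apply: conj_Creal; rewrite realE !lecR le_total.
rewrite rnormZ gtr0_norm// ler_pM2l//; apply: rnorm_inner_unit.
by rewrite rnormZ gtr0_norm ?invr_gt0// mulVf// gt_eqF.
Qed.

End CauchySchwarz.

(** * Idempotents and matched projections *)

Section AbstractOperators.
Context (R : realType) (A : cstarAlgType R).

(** Covers [mp_U] and [mp_A], whose submodules and direct sums carry only an inner module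
    structure. *)
Lemma adj_unique (E F : innerModType A) (T : E -> F) (T' : F -> E) :
  (forall x : E, inner x x = 0 :> A -> x = 0) -> is_adjoint T T' -> adj T = T'.
Proof.
move=> E_def TT'; rewrite /adj; case: xgetP => [S _ /= TS|/(_ T')//].
apply/funext => y; apply/subr0_eq/E_def.
by rewrite innerBr -TS -TT' subrr.
Qed.

Lemma opinv_unique (E F : innerModType A) (T : E -> F) (S : F -> E) :
  S \o T = id -> T \o S = id -> opinv T = S.
Proof.
move=> ST TS; rewrite /opinv.
case: xgetP => [S' _ [/= S'T _]|/(_ S)]; last by case.
by rewrite -[S']/(S' \o id) -TS compA S'T.
Qed.

Variable H : hilbertModType A.
Implicit Types (s S T : 'L(H)).

Lemma op_pos_mul_star T : op_pos (star T * T).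
Proof. exact/op_pos_star_mul/hilbert_cauchy_schwarz. Qed.

Lemma op_pos_conj s T : op_pos s -> op_pos (star T * s * T).
Proof.
move=> /(op_pos_sqrt (@hilbert_cauchy_schwarz _ _ H))[r [[sr _] rr _]].
have -> : star T * s * T = star (r * T) * (r * T).
  by rewrite starM sr -rr !mulrA.
exact: op_pos_mul_star.
Qed.

(** One direction is Fukamiya's theorem; for the other, a positive operator is the square of its
    selfadjoint root. *)
Lemma op_posE (f : H -> H) :
  oppos f <-> exists2 T, op_pos T & T = f :> (H -> H).
Proof.
split=> [[S [aS ->]]|[T pT <-]].
  by exists (star (AdjOp aS) * AdjOp aS) => //; exact: op_pos_mul_star.
have [r [[sr _] rr _]] := op_pos_sqrt (@hilbert_cauchy_schwarz _ _ H) pT.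
exists r; split; first exact: adjOpP.
by rewrite -[adj r]/(star r : H -> H) sr -rr.
Qed.

Lemma opsqrt_unique (f : H -> H) s :
  op_pos s -> (s * s : H -> H) = f -> opsqrt f = s.
Proof.
move=> ps ssf; rewrite /opsqrt; case: xgetP => [g _ [/op_posE[T pT <-] /= TT]|].
  congr (adjOp_fun _); apply: op_pos_sqrt_unique => //.
    exact: hilbert_cauchy_schwarz.
  by apply: adjOp_eqP => x; rewrite -[RHS]/((s * s) x) ssf -TT.
by move=> /(_ s)[]; split=> //; apply/op_posE; exists s.
Qed.

Lemma opabs_unique S s : op_pos s -> s * s = star S * S -> opabs S = s.
Proof. by move=> ps ss; apply: opsqrt_unique => //; rewrite ss. Qed.

Lemma range_mulr S T : range (S * T) `<=` range S.
Proof. by move=> _ [x _ <-]; exists (T x). Qed.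

Lemma range_mulrV S T T' : T * T' = 1 -> range (S * T) = range S.
Proof.
move=> TT'; apply/seteqP; split; first exact: range_mulr.
by rewrite -{1}(mulr1 S) -TT' mulrA; exact: range_mulr.
Qed.

Lemma comm_inv S S' T :
  S * S' = 1 -> S' * S = 1 -> GRing.comm S T -> GRing.comm S' T.
Proof.
move=> SS' S'S ST; rewrite /GRing.comm -[T in LHS]mulr1 -SS' (mulrA T) -ST.
by rewrite !mulrA S'S mul1r.
Qed.

End AbstractOperators.

Section Idempotent.
Context (R : realType) (A : cstarAlgType R) (H : hilbertModType A).
Variable Q : 'L(H).
Hypothesis QQ : Q * Q = Q.
Local Notation Q' := (star Q).
Local Notation J := (Q + Q' - 1).
Let cs := @hilbert_cauchy_schwarz _ _ H.

Lemma star_idem : Q' * Q' = Q'.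
Proof. by rewrite -starM QQ. Qed.

Lemma idem_mul_sqr : Q * (J * J) = Q * Q' * Q.
Proof.
have -> : Q * (J * J) = Q * Q * Q + Q * Q * Q' + Q * (Q' * Q') + Q * Q' * Q
   - Q * Q - Q * Q - Q * Q' - Q * Q' + Q by ncring.
rewrite star_idem !QQ; ncring.
Qed.

Lemma sqr_mul_idem : J * J * Q = Q * Q' * Q.
Proof.
have -> : J * J * Q = Q * (Q * Q) + Q' * (Q * Q) + Q' * Q' * Q + Q * Q' * Q
   - Q * Q - Q * Q - Q' * Q - Q' * Q + Q by ncring.
rewrite star_idem !QQ; ncring.
Qed.

Lemma sqr_comm_idem : GRing.comm (J * J) Q.
Proof. by rewrite /GRing.comm sqr_mul_idem idem_mul_sqr. Qed.

Lemma star_J : star J = J.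
Proof. by rewrite starB starD starK star1 (addrC Q'). Qed.

Lemma sqr_comm_star : GRing.comm (J * J) Q'.
Proof.
by apply: (can_inj (@starK _ _ H)); rewrite !starM star_J starK sqr_comm_idem.
Qed.

Lemma idempotent_modulus : exists N Ni K : 'L(H),
  [/\ op_pos N, N * N = J * J, N * Ni = 1 /\ Ni * N = 1,
      (1 + N) * K = 1 /\ K * (1 + N) = 1 &
      GRing.comm N Q /\ GRing.comm N Q'].
Proof.
have JJ : J * J = 1 + star (Q - Q') * (Q - Q').
  have -> : J * J =
      1 + (Q * Q + Q * Q' + Q' * Q + Q' * Q') - Q - Q - Q' - Q' by ncring.
  rewrite starB starK.
  have -> : (Q' - Q) * (Q - Q') = Q' * Q + Q * Q' - Q' * Q' - Q * Q by ncring.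
  rewrite QQ star_idem; ncring.
have pD := op_pos_mul_star (Q - Q').
have [Mi [MMi MiM]] := op_pos_one_add_inv cs pD.
have p1 : op_pos (1 : 'L(H)).
  by rewrite -(mulr1 1) -{1}star1; exact: op_pos_mul_star.
have [N [pN NN Ncomm]] := op_pos_sqrt cs (op_posD p1 pD).
have [K [NK KN]] := op_pos_one_add_inv cs pN.
(* [Mi] inverts [J ^ 2 = N ^ 2] and commutes with [N], so [N Mi] inverts [N]. *)
exists N, (N * Mi), K; rewrite -JJ in MMi MiM NN Ncomm; split=> //.
- split; first by rewrite mulrA NN.
  have NMi : GRing.comm Mi N.
    by apply: (comm_inv MMi MiM); rewrite -NN; exact/commr_sym/commrM.
  by rewrite -NMi -mulrA NN.
- by split; apply: Ncomm; [exact: sqr_comm_idem|exact: sqr_comm_star].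
Qed.

(** The projection is [Q Q' J^-2]: it is selfadjoint because [J^-2] commutes with [Q] and [Q'], and
    [P Q = Q] because [Q Q' Q = Q J ^ 2]. *)
Lemma range_proj_idem : exists P : 'L(H),
  [/\ range_proj Q = P, star P = P, P * P = P, Q * P = P & P * Q = Q].
Proof.
have [N [Ni [_ [pN NN [NNi NiN] _ [NQ NQ']]]]] := idempotent_modulus.
pose Mi := Ni * Ni.
have MMi : J * J * Mi = 1.
  by rewrite -NN /Mi mulrA -(mulrA N) NNi mulr1 NNi.
have NiQ := comm_inv NNi NiN NQ; have NiQ' := comm_inv NNi NiN NQ'.
have MiQ : GRing.comm Q Mi by apply: commrM; exact: commr_sym.
have MiQ' : GRing.comm Q' Mi by apply: commrM; exact: commr_sym.
have sNi : star Ni = Ni.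
  have sN := pN.1.
  by rewrite -[LHS]mulr1 -NNi mulrA -{1}sN -starM NNi star1 mul1r.
have sMi : star Mi = Mi by rewrite starM sNi.
pose P := Q * Q' * Mi.
have sP : star P = P.
  by rewrite /P starM sMi starM starK mulrA -MiQ -mulrA -MiQ' mulrA.
have PQ : P * Q = Q.
  by rewrite /P -mulrA -MiQ mulrA -idem_mul_sqr -mulrA MMi mulr1.
have QP : Q * P = P by rewrite /P !mulrA QQ.
have PP : P * P = P by rewrite {2}/P mulrA (mulrA P) PQ.
(* [P] shows that the default is not taken; the identities then hold for any projection with the
   range of [Q]. *)
rewrite /range_proj; case: xgetP => [p _ [[/= ap pp] rp]|]; last first.
  move=> /(_ P)[]; split.
    by split; [move=> x y; rewrite inner_star sP|rewrite -{3}PP].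
  apply/seteqP; split; last by rewrite -{1}PQ; exact: range_mulr.
  by rewrite -QP; exact: range_mulr.
pose p' : 'L(H) := AdjOp (ex_intro _ p ap).
exists p'; split=> //.
- exact: star_unique.
- by apply: adjOp_eqP => x; rewrite opE /= -[p (p x)]/((p \o p) x) pp.
- apply: adjOp_eqP => x; rewrite opE /=.
  have [y _ <-] : range Q (p x) by rewrite -rp; exists x.
  exact: (congr1 (fun T : 'L(H) => T y) QQ).
- apply: adjOp_eqP => x; rewrite opE /=.
  have [y _ <-] : range p (Q x) by rewrite rp; exists x.
  by rewrite -[p (p y)]/((p \o p) y) pp.
Qed.

End Idempotent.

(** * Moduli of an idempotent and the range of its matched projection *)

Section IdempotentRanges.
Context (R : realType) (A : cstarAlgType R) (H : hilbertModType A).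
(* [N] is the modulus of [J]; [Ni] and [K] are the inverses of [N] and [1 + N]. *)
Variables Q P N Ni K : 'L(H).
Local Notation Q' := (star Q).
Local Notation J := (Q + Q' - 1).
Hypotheses (QQ : Q * Q = Q) (sP : star P = P) (PP : P * P = P)
  (QP : Q * P = P) (PQ : P * Q = Q) (pN : op_pos N) (NN : N * N = J * J)
  (NNi : N * Ni = 1) (NiN : Ni * N = 1)
  (NK : (1 + N) * K = 1) (KN : K * (1 + N) = 1)
  (NQ : GRing.comm N Q) (NQ' : GRing.comm N Q').
Let cs := @hilbert_cauchy_schwarz _ _ H.

Let Q'Q' := star_idem QQ.

Lemma star_idem_mul_proj : Q' * P = Q'.
Proof. by apply: (can_inj (@starK _ _ H)); rewrite starM sP starK. Qed.

Lemma proj_mul_star_idem : P * Q' = P.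
Proof. by apply: (can_inj (@starK _ _ H)); rewrite starM sP starK. Qed.

Let Q'P := star_idem_mul_proj.
Let PQ' := proj_mul_star_idem.

Lemma proj_mul_modulus_sqr : P * (N * N) = Q * Q'.
Proof.
rewrite NN; have -> : P * (J * J) = P * Q * Q + P * Q * Q' + P * Q' * Q
   + P * Q' * Q' - P * Q - P * Q - P * Q' - P * Q' + P by ncring.
rewrite !(PQ, PQ', QQ); ncring.
Qed.

Lemma modulus_sqr_mul_proj : N * N * P = Q * Q'.
Proof.
rewrite NN; have -> : J * J * P = Q * (Q * P) + Q * (Q' * P) + Q' * (Q * P)
   + Q' * (Q' * P) - Q * P - Q * P - Q' * P - Q' * P + P by ncring.
rewrite !(QP, Q'P, Q'Q'); ncring.
Qed.

(** By uniqueness [N] is the root of [N ^ 2] given by [op_pos_sqrt]; that root commutes with [P]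
    because [N ^ 2 P] and [P N ^ 2] both equal [Q Q']. *)
Lemma modulus_comm_proj : GRing.comm N P.
Proof.
have [n [pn nn ncomm]] := op_pos_sqrt cs (op_pos_mul_star N).
have sN := pN.1.
have -> : N = n by apply: (op_pos_sqrt_unique cs) => //; rewrite nn sN.
apply: ncomm; rewrite /GRing.comm sN.
by rewrite modulus_sqr_mul_proj -proj_mul_modulus_sqr.
Qed.

Let NP := modulus_comm_proj.
Let NiQ := comm_inv NNi NiN NQ.
Let NiP := comm_inv NNi NiN NP.

Let N1_comm T : GRing.comm N T -> GRing.comm (1 + N) T.
Proof.
by move=> NT; apply/commr_sym/commrD; [exact: commr1|exact: commr_sym].
Qed.

Let K_comm T : GRing.comm N T -> GRing.comm K T.
Proof. by move=> NT; apply: (comm_inv NK KN); exact: N1_comm. Qed.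

Let G_comm T : GRing.comm N T -> GRing.comm (K * Ni) T.
Proof.
move=> NT; apply/commr_sym/commrM; apply: commr_sym; first exact: K_comm.
exact: comm_inv NNi NiN NT.
Qed.

Lemma opabs_star_idem : opabs (adj Q) = N * P.
Proof.
apply: (@opabs_unique _ _ _ Q').
  have -> : N * P = star P * N * P by rewrite sP -NP -mulrA PP.
  exact: op_pos_conj.
rewrite starK -modulus_sqr_mul_proj -(mulrA N P) (mulrA P) -NP.
by rewrite -(mulrA N P P) PP mulrA.
Qed.

(** The square is [Q' N^-1 (Q Q') N^-1 Q], where [Q Q' = N ^ 2 P] absorbs both inverses and
    [P Q = Q]. *)
Lemma opabs_idem : opabs Q = Q' * Ni * Q.
Proof.
have pNi : op_pos Ni.
  have sNi : star Ni = Ni.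
    by rewrite -[LHS]mulr1 -NNi mulrA -{1}pN.1 -starM NNi star1 mul1r.
  have -> : Ni = star Ni * N * Ni by rewrite sNi NiN mul1r.
  exact: op_pos_conj.
apply: opabs_unique; first exact: op_pos_conj.
have -> : Q' * Ni * Q * (Q' * Ni * Q) = Q' * Ni * (Q * Q') * (Ni * Q).
  by rewrite !mulrA.
rewrite -modulus_sqr_mul_proj NiQ -(mulrA (Q' * Ni)) (mulrA _ Q Ni).
rewrite -(mulrA (N * N) P Q) PQ -(mulrA (N * N) Q) -NiQ !mulrA.
by rewrite -(mulrA Q' Ni N) NiN mulr1 -(mulrA Q' N Ni) NNi mulr1.
Qed.

Lemma range_opabs_add : range (Q + Q') = range (opabs (adj Q) \+ opabs Q).
Proof.
have -> : opabs (adj Q) \+ opabs Q = N * P + Q' * Ni * Q :> (H -> H).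
  by rewrite opabs_star_idem opabs_idem.
have -> : N * P + Q' * Ni * Q = (Q + Q') * (J * Ni).
  have -> : N * P = Q * Q' * Ni.
    by rewrite -proj_mul_modulus_sqr -!mulrA NNi mulr1 NP.
  rewrite -(mulrA Q' Ni) NiQ !mulrA -mulrDl; congr (_ * _).
  have -> : (Q + Q') * J = Q * Q + Q * Q' - Q + Q' * Q + Q' * Q' - Q' by ncring.
  rewrite QQ Q'Q'; ncring.
(* A right inverse of [J N^-1], because [J ^ 2 = N ^ 2]. *)
rewrite (@range_mulrV _ _ _ _ _ (N * J * (Ni * Ni)))//.
rewrite -(mulrA N) mulrA -(mulrA J) NiN mulr1.
by rewrite mulrA -NN mulrA -(mulrA N) NNi mulr1.
Qed.

(* As [N] commutes with [P], [Q] and [Q'], this is [W (2 N (N + 1))^-1 W^*] with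
   [W = (N + Q') P]. *)
Definition matched_op : 'L(H) :=
  2^-1 *: (K * Ni * (N + Q') * (N * P + Q)).

(** The summands are the four matrix entries, with [N] for [B], [Q - P] for [A] and [Q' - 1] for
    [A^*]. Since [N^-1 = G (1 + N)] and [G] commutes with [N] and [Q'], each has the left factor
    [G]. *)
Lemma matched_opE : matched_op =
  2^-1 *: ((1 + N) * Ni * P + Ni * (Q - P) + (Q' - 1) * Ni * P
           + (Q' - 1) * (K * Ni) * (Q - P)).
Proof.
congr (_ *: _); set G := K * Ni.
have GQ' : GRing.comm G Q' by exact: G_comm.
have GN : Ni = G * (1 + N).
  have -> : G * (1 + N) = K * (1 + N) * Ni.
    by rewrite /G mulrDr mulrDr mulrDl !mulr1 -!mulrA NiN NNi.
  by rewrite KN mul1r.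
have N1 : GRing.comm (1 + N) G by apply/N1_comm/commr_sym/G_comm.
have -> : (1 + N) * Ni * P = G * ((1 + N) * (1 + N) * P).
  by rewrite GN mulrA N1 !mulrA.
have -> : (Q' - 1) * Ni * P = G * ((Q' - 1) * (1 + N) * P).
  have Q1G : GRing.comm (Q' - 1) G.
    by apply/commr_sym/commrB => //; exact: commr1.
  by rewrite GN mulrA Q1G !mulrA.
have -> : (Q' - 1) * G * (Q - P) = G * ((Q' - 1) * (Q - P)).
  have Q1G : GRing.comm (Q' - 1) G.
    by apply/commr_sym/commrB => //; exact: commr1.
  by rewrite Q1G !mulrA.
rewrite GN -(mulrA G (1 + N)) -!mulrDr -mulrA; congr (_ * _).
rewrite mulrDr (mulrDl N) (mulrDl N) !mulrA; ncring.
Qed.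

(** With [W = (N + Q') P], one inclusion comes from [W] being a left factor of [matched_op], the
    other from [matched_op * W = W]. *)
Lemma range_matched_op : range matched_op = range ((N + Q') * P).
Proof.
set G := K * Ni.
have GQ' : GRing.comm G Q' by exact: G_comm.
have GN : GRing.comm G N by exact: G_comm.
have GP : GRing.comm G P by exact: G_comm.
have GNQ' : GRing.comm G (N + Q') by exact: commrD.
apply/seteqP; split.
  have -> : matched_op = (N + Q') * P * (2^-1 *: (G * (N * P + Q))).
    have PG : P * (G * (N * P + Q)) = G * (N * P + Q).
      by rewrite mulrA -GP -mulrA mulrDr PQ mulrA -NP -(mulrA N) PP.
    by rewrite /matched_op -/G GNQ' op_scaleAr -(mulrA _ P) PG mulrA.
  exact: range_mulr.
have -> : (N + Q') * P = matched_op * ((N + Q') * P).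
  (* This is [W^* W = 2 N (N + 1) P]. *)
  have e : (N * P + Q) * ((N + Q') * P) = N * (1 + N) * P + N * (1 + N) * P.
    have -> : (N * P + Q) * ((N + Q') * P) =
       N * (P * N) * P + N * (P * Q') * P + Q * N * P + Q * Q' * P by ncring.
    rewrite PQ' -NP -NQ -modulus_sqr_mul_proj.
    have -> : N * (N * P) * P = N * N * (P * P) by rewrite !mulrA.
    rewrite -(mulrA (N * N)) -!(mulrA N P) -(mulrA N Q) QP PP; ncring.
  rewrite /matched_op -/G op_scaleAl -mulrA e.
  rewrite mulrDr; set T := _ * _ * (_ * P).
  have -> : T = (N + Q') * P.
    rewrite /T GNQ' -!mulrA; congr (_ * _); rewrite /G.
    by rewrite !mulrA -(mulrA K) NiN mulr1 KN mul1r.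
  have -> : 2^-1 = (2^-1 : R)%:C :> R[i] by rewrite fmorphV /= rmorph_nat.
  by rewrite op_half.
exact: range_mulr.
Qed.

Lemma range_matched_sub : range matched_op `<=` range (Q + Q').
Proof.
rewrite range_matched_op.
have -> : (N + Q') * P = (Q + Q') * ((P * N + Q' * P) * K).
  (* [Q P N = N P] and [Q Q' P = N ^ 2 P] turn [(Q + Q') (P N + Q' P)] into [(N + Q') P (1 + N)]. *)
  have -> : (Q + Q') * ((P * N + Q' * P) * K) = (N + Q') * P * ((1 + N) * K).
    rewrite !mulrA; congr (_ * _).
    have -> : (Q + Q') * (P * N + Q' * P) =
        Q * P * N + Q * Q' * P + Q' * P * N + Q' * Q' * P by ncring.
    have -> : (N + Q') * P * (1 + N) =
        N * P + N * (P * N) + Q' * P + Q' * P * N by ncring.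
    rewrite QP -NP -modulus_sqr_mul_proj Q'Q' -(mulrA (N * N)) PP; ncring.
  by rewrite NK mulr1.
exact: range_mulr.
Qed.

Lemma range_matched_eq : range matched_op = range (Q + Q') -> star Q = Q.
Proof.
rewrite range_matched_op => eqR.
suff QP0 : Q * (1 - P) = 0.
  have -> : Q = Q * (1 - P) + Q * P by rewrite mulrBr mulr1 subrK.
  by rewrite QP0 add0r QP.
apply: adjOp_eqP => h; pose y := (1 - P) h.
have Q'y : Q' y = 0.
  by rewrite /y -[LHS]/((Q' * (1 - P)) h) mulrBr mulr1 Q'P subrr.
have [x _ xy] : range ((N + Q') * P) ((Q + Q') y) by rewrite eqR; exists y.
have {}xy : Q y = N (P x) + Q' (P x).
  by move: xy; rewrite !opE Q'y addr0 => <-.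
have Q'x : Q' (P x) = P x.
  apply/subr0_eq; rewrite -[LHS]/((Q' * P - P) x).
  (* Applying [1 - P] to [Q y = N P x + Q' P x] kills [Q y] and [N P x], while [P Q' = P]. *)
  have -> : Q' * P - P = (1 - P) * (N * P + Q' * P).
    have -> : (1 - P) * (N * P + Q' * P) =
        N * P + Q' * P - P * N * P - P * Q' * P by ncring.
    by rewrite -NP PQ' -mulrA PP; ncring.
  have -> : ((1 - P) * (N * P + Q' * P)) x = ((1 - P) * Q) y.
    by rewrite !opE xy.
  by rewrite mulrBl mul1r PQ subrr.
have NNx : N (N (P x)) = P x.
  rewrite -[LHS]/((N * N * P) x) modulus_sqr_mul_proj -{1}Q'P.
  by rewrite -[LHS]/(Q (Q' (P x))) Q'x -[LHS]/((Q * P) x) QP.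
have Nx : N (P x) = P x.
  (* [(1 + N) (N P x - P x) = N ^ 2 P x - P x = 0], and [1 + N] is invertible. *)
  apply/subr0_eq; have : (K * (1 + N)) (N (P x) - P x) = 0.
    by rewrite !opE adjOpB NNx addrC subrKA subrr adjOp0.
  by rewrite KN.
have Q'Qy : Q' (Q y) = Q y.
  by rewrite xy Nx adjOpD !Q'x.
(* [<Q y, Q y> = <y, Q y> = <P y, Q y>], and [P y = 0]. *)
rewrite -[LHS]/(Q y); apply: (@inner_eq0 _ _ H); rewrite inner_star Q'Qy.
rewrite (_ : Q y = P (Q y)); last by rewrite -[RHS]/((P * Q) y) PQ.
rewrite -sP -inner_star (_ : P y = 0) ?inner0l//.
by rewrite -[LHS]/((P * (1 - P)) h) mulrBr mulr1 PP subrr.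
Qed.

(** * The operator matrix in the definition of the matched projection *)

Hypothesis range_projE : range_proj Q = P.

Local Notation rQ := (submodule_of (range_sub Q)).
Local Notation nQ := (submodule_of (null_sub (adjOp_adj Q))).

Lemma val_insubd_range x : P x = x -> val (insubd (0 : rQ) x) = x.
Proof.
move=> Px; apply: insubdK; apply/mem_set; exists x => //.
by rewrite -{1}Px -[LHS]/((Q * P) x) QP.
Qed.

Lemma val_insubd_null x : Q' x = 0 -> val (insubd (0 : nQ) x) = x.
Proof. by move=> Q'x; apply: insubdK; rewrite inE; apply/eqP. Qed.

Lemma proj_val (x : rQ) : P (val x) = val x.
Proof.
have [y _ <-] := set_mem (valP x).
by rewrite -[LHS]/((P * Q) y) PQ.
Qed.

Lemma insubd_val (x : rQ) : insubd 0 (val x) = x.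
Proof. exact: valKd. Qed.

Lemma star_val (y : nQ) : Q' (val y) = 0.
Proof. by have := valP y; rewrite inE => /eqP. Qed.

Lemma proj_null x : Q' x = 0 -> P x = 0.
Proof. by move=> Q'x; rewrite -PQ' opE Q'x adjOp0. Qed.

Lemma sub_inner_eq0 (S : submodule H) (x : submodule_of S) :
  inner x x = 0 :> A -> x = 0.
Proof. by move=> x0; apply/val_inj/(@inner_eq0 _ _ H). Qed.

Lemma val_submoduleD (S : submodule H) (x y : submodule_of S) :
  val (x + y) = val x + val y :> H.
Proof. exact: raddfD. Qed.

Lemma star_proj_compl h : Q' (h - P h) = 0.
Proof. by rewrite adjOpB -[Q' (P h)]/((Q' * P) h) Q'P subrr. Qed.

(** Meaningful for [T] commuting with [P], which then maps the range of [Q] into itself. *)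
Definition restrict (T : 'L(H)) (x : rQ) : rQ := insubd 0 (T (val x)).

Lemma val_restrict T x : GRing.comm T P -> val (restrict T x) = T (val x).
Proof.
by move=> TP; rewrite val_insubd_range// -[LHS]/((P * T) _) -TP opE proj_val.
Qed.

Lemma restrictM S T : GRing.comm S P -> GRing.comm T P ->
  restrict S \o restrict T = restrict (S * T).
Proof.
move=> SP TP; apply/funext => x; apply: val_inj => /=.
by rewrite !val_restrict//; apply/commr_sym/commrM; exact: commr_sym.
Qed.

Lemma restrict1 : restrict 1 = id.
Proof. by apply/funext => x; rewrite /restrict opE insubd_val. Qed.

Lemma restrict_adjoint T : GRing.comm T P -> star T = T ->
  is_adjoint (restrict T) (restrict T).
Proof.
move=> TP sT x y; rewrite /inner /= /sub_inner !val_restrict//.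
by rewrite inner_star sT.
Qed.

(** Extension by 0 on the null space of [P], for linear [f]. It moves operators on the range of [Q]
    to [H], where uniqueness of positive roots has been proved. *)
Definition extend (f : rQ -> rQ) (h : H) : H := val (f (insubd 0 (P h))).

Let projK h : P (P h) = P h. Proof. by rewrite -[LHS]/((P * P) h) PP. Qed.

Lemma extend_adjoint f g : is_adjoint f g -> is_adjoint (extend f) (extend g).
Proof.
have ext_inner (k : rQ -> rQ) x y :
    inner (extend k x) y =
    inner (k (insubd 0 (P x))) (insubd (0 : rQ) (P y)) :> A.
  rewrite /extend -[X in inner X y]proj_val -{1}sP inner_starl.
  by rewrite [in RHS]/inner /= /sub_inner (val_insubd_range (projK y)).
by move=> fg x y; rewrite ext_inner fg innerC -ext_inner -innerC.
Qed.

Lemma extend_comp f g : extend (f \o g) = extend f \o extend g.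
Proof. by apply/funext => h; rewrite /extend /= proj_val insubd_val. Qed.

(** A positive root [T^* T] on the range of [Q] extends to a positive operator on [H] with square
    [N ^ 2 P = (N P) ^ 2], which is [N P] by uniqueness on [H]. *)
Lemma mp_B_eq (f : rQ -> rQ) : f = restrict (N * N) -> opsqrt f = restrict N.
Proof.
move=> fE; have [n [[sn _] nn ncomm]] := op_pos_sqrt cs pN.
have nP := ncomm _ NP.
rewrite /opsqrt; case: xgetP => [S _ [[T [[T' TT'] ->]] /= SS]|]; last first.
  (* The default is excluded: [restrict N] is a positive root, being the square of the selfadjoint
     [restrict n]. *)
  move=> /(_ (restrict N))[]; split; last by rewrite restrictM// fE.
  have n_adj := restrict_adjoint nP sn.
  exists (restrict n); split; first by exists (restrict n).
  by rewrite (adj_unique _ n_adj) ?restrictM ?nn//; exact: sub_inner_eq0.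
have adjT : adj T = T' by apply: adj_unique TT'; exact: sub_inner_eq0.
rewrite adjT in SS *.
pose t : 'L(H) := AdjOp (ex_intro _ _ (extend_adjoint TT')).
have tt : (star t * t : H -> H) = extend (T' \o T).
  by rewrite extend_comp -(is_adjointP (extend_adjoint TT')).
have tN : star t * t = N * P.
  apply: (op_pos_sqrt_unique cs).
  - exact: op_pos_mul_star.
  - have -> : N * P = star P * N * P by rewrite sP -NP -mulrA PP.
    exact: op_pos_conj.
  pose f2 : H -> H := star t * t.
  apply: adjOp_eqP => h; rewrite -[LHS]/((f2 \o f2) h) /f2 tt.
  rewrite -extend_comp SS fE /extend val_restrict; last first.
    by apply/commr_sym/commrM; exact/commr_sym/NP.
  rewrite val_insubd_range ?projK// -[LHS]/((N * N * P) h).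
  by rewrite -(mulrA N P) (mulrA P) -NP -(mulrA N P P) PP mulrA.
apply/funext => x; apply: val_inj; rewrite val_restrict//.
have : (star t * t) (val x) = (N * P) (val x) by rewrite tN.
by rewrite tt /extend opE proj_val insubd_val.
Qed.

Lemma adj_mp_U : adj (mp_U Q) = (fun u : rQ * nQ => val u.1 + val u.2).
Proof.
apply: adj_unique => [x|h u]; first exact: inner_eq0.
rewrite /mp_U range_projE /inner /= /pair_inner /= /inner /= /sub_inner.
rewrite val_insubd_range ?projK// val_insubd_null ?star_proj_compl//.
have Pinner x y : inner (P x) y = inner x (P y) :> A.
  by rewrite -{1}sP inner_starl.
rewrite innerBl !Pinner proj_val (proj_null (star_val u.2)) inner0r subr0.
by rewrite -innerDr.
Qed.

Lemma val_mp_A (y : nQ) : val (mp_A y) = Q (val y).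
Proof.
rewrite /mp_A range_projE (proj_null (star_val y)) subr0 val_insubd_range//.
by rewrite -[LHS]/((P * Q) _) PQ.
Qed.

(** [P Q' = P] is the identity on the range of [Q], so this is [(1 - P) Q'] there. *)
Definition mp_A_adj (x : rQ) : nQ := insubd 0 (Q' (val x) - val x).

Lemma val_mp_A_adj x : val (mp_A_adj x) = Q' (val x) - val x.
Proof.
apply: val_insubd_null; rewrite adjOpB.
by rewrite -[Q' (Q' _)]/((Q' * Q') _) Q'Q' subrr.
Qed.

Lemma adj_mp_A : adj (@mp_A _ _ _ Q) = mp_A_adj.
Proof.
apply: adj_unique => [y|y x]; first exact: sub_inner_eq0.
rewrite /inner /= /sub_inner val_mp_A val_mp_A_adj innerBr -inner_star.
rewrite -[X in _ = _ - inner _ X]proj_val -{1}sP -inner_star.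
by rewrite (proj_null (star_val y)) inner0l subr0.
Qed.

(** On the range of [Q], [A A^* x + x = Q (Q' x - x) + x = Q Q' x = N ^ 2 x]. *)
Lemma mp_B_restrict : @mp_B _ _ _ Q = restrict N.
Proof.
apply: mp_B_eq; apply/funext => x; apply: val_inj.
rewrite adj_mp_A val_restrict; last first.
  by apply/commr_sym/commrM; exact/commr_sym/NP.
rewrite -[LHS]/(val (mp_A (mp_A_adj x) + x)).
rewrite val_submoduleD val_mp_A val_mp_A_adj.
rewrite adjOpB -[Q (val x)]/(Q (val x)).
rewrite -[Q (Q' _)]/((Q * Q') _) -modulus_sqr_mul_proj opE proj_val.
have -> : Q (val x) = val x by rewrite -proj_val -[LHS]/((Q * P) _) QP.
by rewrite subrK.
Qed.

Lemma opinv_restrict S T : GRing.comm S P -> GRing.comm T P ->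
  S * T = 1 -> T * S = 1 -> opinv (restrict S) = restrict T.
Proof.
move=> SP TP ST TS; apply: opinv_unique; rewrite restrictM ?ST ?TS ?restrict1//.
Qed.

(** The inverses of [B] and [B (B + 1)] are the restrictions of [Ni] and [K Ni]; the entries applied
    to [P h] and [h - P h] are then the summands of [matched_opE]. *)
Lemma matched_proj_nonproj : ~ projection Q ->
  matched_proj Q = matched_op.
Proof.
move=> nprojQ; rewrite /matched_proj; case: asboolP => // _.
apply/funext => h; rewrite [LHS]/= adj_mp_U.
have N1P : GRing.comm (1 + N) P by exact: N1_comm.
have B1 : @mp_B _ _ _ Q \+ id = restrict (1 + N).
  apply/funext => x; apply: val_inj.
  rewrite mp_B_restrict -[LHS]/(val (restrict N x + x)) val_submoduleD.
  by rewrite !val_restrict// opE addrC.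
have KNiP : GRing.comm (K * Ni) P by exact: G_comm.
have BB1 : @mp_B _ _ _ Q \o (@mp_B _ _ _ Q \+ id) = restrict (N * (1 + N)).
  by rewrite B1 mp_B_restrict restrictM.
have N1 : N * (1 + N) * (K * Ni) = 1.
  by rewrite -(mulrA N) (mulrA (1 + N)) NK mul1r.
have KNi : K * Ni * (N * (1 + N)) = 1.
  by rewrite -(mulrA K) (mulrA Ni) NiN mul1r.
have NN1P : GRing.comm (N * (1 + N)) P.
  by apply/commr_sym/commrM; exact: commr_sym.
rewrite /mp_mx BB1 B1 (opinv_restrict NN1P KNiP N1 KNi).
rewrite mp_B_restrict (opinv_restrict NP NiP NNi NiN) adj_mp_A.
rewrite /mp_U range_projE [LHS]/= matched_opE.
set a := insubd _ (P h); set b := insubd _ (h - P h).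
have va : val a = P h by apply: val_insubd_range.
have vb : val b = h - P h by apply/val_insubd_null/star_proj_compl.
have vAb : val (mp_A b) = (Q - P) h.
  by rewrite val_mp_A vb adjOpB -[Q (P h)]/((Q * P) h) QP.
have -> : submodule_val (restrict (1 + N) (restrict Ni a)) =
    ((1 + N) * Ni * P) h.
  by rewrite -[LHS]/(val _) !val_restrict// va.
have -> : submodule_val (restrict Ni (mp_A b)) = (Ni * (Q - P)) h.
  by rewrite -[LHS]/(val _) val_restrict// vAb.
have -> : submodule_val (mp_A_adj (restrict Ni a)) = ((Q' - 1) * Ni * P) h.
  by rewrite -[LHS]/(val _) val_mp_A_adj val_restrict// va.
have -> : submodule_val (mp_A_adj (restrict (K * Ni) (mp_A b))) =
    ((Q' - 1) * (K * Ni) * (Q - P)) h.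
  by rewrite -[LHS]/(val _) val_mp_A_adj val_restrict// vAb.
by rewrite -scalerDr addrA.
Qed.

End IdempotentRanges.

Lemma projection_star (R : realType) (A : cstarAlgType R) (H : hilbertModType A)
    (Q : 'L(H)) :
  Q * Q = Q -> projection Q <-> star Q = Q.
Proof.
move=> QQ; split=> [[aQ _]|sQ]; first exact: star_unique.
by split; [move=> x y; rewrite inner_star sQ|rewrite -{3}QQ].
Qed.

Local Close Scope complex_scope.

Theorem theorem3p11 (R : realType) (A : cstarAlgType R) (H : hilbertModType A)
    (Q : 'L(H)) (hQ : Q \o Q = Q :> (H -> H)) :
  [/\ range (matched_proj Q) `<=` range (Q \+ adj Q),
      range (Q \+ adj Q) = range (opabs (adj Q) \+ opabs Q) &
      range (matched_proj Q) = range (Q \+ adj Q) <-> projection Q].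
Proof.
have QQ : Q * Q = Q.
  by apply: adjOp_eqP => x; rewrite opE -[LHS]/((Q \o Q) x) hQ.
have [N [Ni [K [pN NN [NNi NiN] [NK KN] [NQ NQ']]]]] := idempotent_modulus QQ.
have [P [PE sP PP QP PQ]] := range_proj_idem QQ.
have absE := range_opabs_add QQ sP PP QP PQ pN NN NNi NiN NQ.
have addE : range (Q \+ adj Q) = range (Q + star Q) by [].
rewrite addE; have [projQ|nprojQ] := pselect (projection Q).
  (* For a projection, [m(Q) = Q] and [Q + Q' = 2 Q], which has the range of [Q]. *)
  have matchedE : range (matched_proj Q) = range (Q + star Q).
    rewrite /matched_proj asboolT// (projection_star QQ).1//.
    have QZ : Q + Q = Q * (2%:R *: (1 : 'L(H))).
      by rewrite op_scaleAr mulr1 scaler_nat mulr2n.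
    rewrite QZ (@range_mulrV _ _ _ _ _ (2^-1 *: (1 : 'L(H))))//.
    by rewrite op_scaleAl op_scaleAr mul1r scalerA divff ?scale1r// pnatr_eq0.
  by split; rewrite ?matchedE.
rewrite (matched_proj_nonproj QQ sP PP QP PQ pN NN NNi NiN NK KN NQ' PE nprojQ).
split.
- exact: (range_matched_sub QQ sP PP QP PQ pN NN NNi NiN NK KN NQ NQ').
- exact: absE.
split=> // mE; case: nprojQ; apply/(projection_star QQ).
exact: (range_matched_eq QQ sP PP QP PQ pN NN NNi NiN NK KN NQ NQ').
Qed.
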